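(* Let $m,n,r,l$ be positive integers with $r<n\le m$, $r\le l<\min(m,n)$, $n>36r$ and $l>22(r-1)$. Fix constants $\sigma_1\ge\sigma_2\ge\dots\ge\sigma_n\ge 0$ with $\sigma_r>0$ and put $$\Sigma_r=\operatorname{diag}(\sigma_j)_{j=1}^r\in\mathbb R^{r\times r},\qquad \Sigma_\perp=\begin{bmatrix}\operatorname{diag}(\sigma_j)_{j=r+1}^n\\ O_{m-n,n-r}\end{bmatrix}\in\mathbb R^{(m-r)\times(n-r)}.$$ Let $G$ be an $r\times n$ Gaussian matrix, let $Q\in\mathbb R^{n\times r}$ and $Q_\perp\in\mathbb R^{n\times(n-r)}$ be matrices whose columns form orthonormal bases of the row space of $G$ and of its orthogonal complement in $\mathbb R^n$, respectively, let $U\in\mathbb R^{m\times m}$ have orthonormal columns, and let $$M=U\begin{bmatrix}\Sigma_r&0\\0&\Sigma_\perp\end{bmatrix}\begin{bmatrix}Q^T\\Q_\perp^T\end{bmatrix}.$$ Let $H\in\mathbb R^{n\times l}$ be a constant matrix, let $T\in\mathbb R^{l\times l}$ be nonsingular, and let $X=MHT^{-1}$ and $Y=X^+M$ be the output of the column-sketching low rank approximation algorithm applied to $M$ with the sketch matrix $H$. Let $|||\cdot|||$ denote either the spectral norm or the Frobenius norm. (i) If $H$ has orthonormal columns, then $$|||M-XY|||/\tilde\sigma_{r+1}(M)\le\sqrt{1+16\,n/l}$$ with a probability no less than $1-\exp(-\frac{n}{72})-\exp(-\frac{l-r}{20})$. (ii) If $H$ has full rank $l$, then $$|||M-XY|||/\tilde\sigma_{r+1}(M)\le\sqrt{1+16\,\kappa^2(H)\,n/l}$$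 with a probability no less than $1-\exp(-\frac{n}{72})-\exp(-\frac{l-r}{20})$.
   Context: All matrices are real. A Gaussian matrix is a matrix filled with independent standard normal random variables; a constant matrix is a non-random one. Events of probability $0$ (such as rank deficiency of $G$) are disregarded. The matrices $Q,Q_\perp,U$ are not uniquely determined by $G$; the result holds for any choice. $A^+$ denotes the Moore–Penrose pseudo inverse. $\sigma_j(A)$ is the $j$th largest singular value of $A$. $\kappa(H)=\|H\|_2\|H^+\|_2$ is the spectral condition number. $M_r$ denotes the rank-$r$ truncation of $M$ (set to $0$ all singular values $\sigma_j(M)$ with $j>r$ in an SVD of $M$), and $\tilde\sigma_{r+1}(M):=|||M-M_r|||$; thus $\tilde\sigma_{r+1}(M)=\sigma_{r+1}(M)$ for the spectral norm and $\tilde\sigma_{r+1}(M)^2=\sum_{j>r}\sigma_j(M)^2$ for the Frobenius norm. The ratio in the conclusion presupposes $\tilde\sigma_{r+1}(M)>0$. Column-sketching algorithm: given $M\in\mathbb R^{m\times n}$, a target rank $r$, and a sketch matrix $H\in\mathbb R^{n\times l}$ of full rank $l$ ($r\le l\le n$), fix a nonsingular $T\in\mathbb R^{l\times l}$ and output $X=MHT^{-1}\in\mathbb R^{m\times l}$ and $Y=\operatorname{argmin}_V|||XV-M|||=X^+M\in\mathbb R^{l\times n}$; the approximation to $M$ is $XY$. *)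

(* Defs.v *)
From HB Require Import structures.
From mathcomp Require Import all_boot all_order all_algebra.
From mathcomp Require Import all_classical all_reals all_analysis.
Set Implicit Arguments.
Unset Strict Implicit.
Unset Printing Implicit Defensive.
Import Order.TTheory GRing.Theory Num.Theory.
Import numFieldNormedType.Exports.

Local Open Scope classical_set_scope.
Local Open Scope ring_scope.

Definition orthonormal_cols (R : realType) (p k : nat) (A : 'M[R]_(p, k)) : Prop :=
  A^T *m A = 1%:M.

Inductive norm_kind := Spectral | Frobenius.

Definition frobenius_norm (R : realType) (p q : nat) (A : 'M[R]_(p, q)) : R :=
  Num.sqrt (\sum_i \sum_j A i j ^+ 2).

(* On column vectors, [frobenius_norm] is the Euclidean norm. *)
Definition spectral_norm (R : realType) (p q : nat) (A : 'M[R]_(p, q)) : R :=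
  sup [set frobenius_norm (A *m x) | x in [set x : 'cV[R]_q | frobenius_norm x <= 1]].

Definition mxnorm (R : realType) (k : norm_kind) (p q : nat) (A : 'M[R]_(p, q)) : R :=
  match k with
  | Spectral => spectral_norm A
  | Frobenius => frobenius_norm A
  end.

(* The four Penrose equations; over the reals they have exactly one solution B,
   so the default value 0 in [pinv] is never used. *)
Definition is_pinv (R : realType) (p q : nat) (A : 'M[R]_(p, q)) (B : 'M[R]_(q, p)) : Prop :=
  [/\ A *m B *m A = A,
      B *m A *m B = B,
      (A *m B)^T = A *m B &
      (B *m A)^T = B *m A].

Definition pinv (R : realType) (p q : nat) (A : 'M[R]_(p, q)) : 'M[R]_(q, p) :=
  xget 0 [set B | is_pinv A B].

Definition cond_number (R : realType) (p q : nat) (A : 'M[R]_(p, q)) : R :=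
  spectral_norm A * spectral_norm (pinv A).

(* Sequences of singular values are indexed from 1, as s 1, ..., s k; the
   other values of s are irrelevant. *)
Definition noninc_nonneg (R : realType) (k : nat) (s : nat -> R) : Prop :=
  (forall i j : nat, (0 < i)%N -> (i <= j)%N -> (j <= k)%N -> s j <= s i) /\
  (forall j : nat, (0 < j)%N -> (j <= k)%N -> 0 <= s j).

(* The rectangular diagonal matrix with diagonal s 1, s 2, ... *)
Definition rdiag_mx (R : realType) (p q : nat) (s : nat -> R) : 'M[R]_(p, q) :=
  \matrix_(i, j) (if i == j :> nat then s i.+1 else 0).

Definition is_svd (R : realType) (p q : nat) (A : 'M[R]_(p, q))
    (U : 'M[R]_p) (s : nat -> R) (V : 'M[R]_q) : Prop :=
  [/\ orthonormal_cols U, orthonormal_cols V, noninc_nonneg (minn p q) s &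
      A = U *m rdiag_mx p q s *m V^T].

(* The truncation itself may depend on the chosen SVD (when the r-th and
   (r+1)-st singular values coincide), but not the norm of its difference
   with A.  Every real matrix has an SVD, so the default 0 is never used. *)
Definition rank_trunc (R : realType) (r p q : nat) (A : 'M[R]_(p, q)) : 'M[R]_(p, q) :=
  xget 0 [set B | exists U s V, is_svd A U s V /\
    B = U *m rdiag_mx p q (fun j => if (j <= r)%N then s j else 0) *m V^T].

(* tail_sigma k r A is the quantity written sigma-tilde_(r+1)(A). *)
Definition tail_sigma (R : realType) (k : norm_kind) (r p q : nat) (A : 'M[R]_(p, q)) : R :=
  mxnorm k (A - rank_trunc r A).

Definition Sigma_r (R : realType) (r : nat) (sigma : nat -> R) : 'M[R]_r :=
  diag_mx (\row_(j < r) sigma j.+1).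

(* The diagonal matrix of sigma (r+1), ..., sigma n on top of m - n zero rows. *)
Definition Sigma_perp (R : realType) (m n r : nat) (sigma : nat -> R) : 'M[R]_(m - r, n - r) :=
  rdiag_mx (m - r) (n - r) (fun j => sigma (r + j)%N).

(* The cast only turns the row dimension r + (m - r) into m. *)
Definition factor_mx (R : realType) (m n r : nat) (hrm : (r <= m)%N) (sigma : nat -> R)
    (U : 'M[R]_m) (Q : 'M[R]_(n, r)) (Qperp : 'M[R]_(n, n - r)) : 'M[R]_(m, n) :=
  U *m castmx (subnKC hrm, erefl)
         (block_mx (Sigma_r r sigma) 0 0 (Sigma_perp m n r sigma))
    *m col_mx Q^T Qperp^T.

Definition sketch_X (R : realType) (m n l : nat) (M : 'M[R]_(m, n))
    (H : 'M[R]_(n, l)) (T : 'M[R]_l) : 'M[R]_(m, l) :=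
  M *m H *m invmx T.

Definition sketch_Y (R : realType) (m n l : nat) (M : 'M[R]_(m, n))
    (H : 'M[R]_(n, l)) (T : 'M[R]_l) : 'M[R]_(l, n) :=
  pinv (sketch_X M H T) *m M.

(* The columns of Q form an orthonormal basis of the row space of G. *)
Definition row_space_onb (R : realType) (r n k : nat) (G : 'M[R]_(r, n)) (Q : 'M[R]_(n, k)) : Prop :=
  orthonormal_cols Q /\ (Q^T == G)%MS.

(* The same for the orthogonal complement of the row space: the row space of
   kermx G^T consists of the row vectors v with v *m G^T = 0. *)
Definition row_space_perp_onb (R : realType) (r n k : nat) (G : 'M[R]_(r, n)) (Q : 'M[R]_(n, k)) : Prop :=
  orthonormal_cols Q /\ (Q^T == kermx G^T)%MS.

Definition mutually_independent (d : measure_display) (Omega : measurableType d)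
    (R : realType) (P : probability Omega R) (I : finType) (X : I -> {RV P >-> R}) : Prop :=
  forall (J : {set I}) (B : I -> set R), (forall i, measurable (B i)) ->
    P (\bigcap_(i in [set i | i \in J]) (X i @^-1` B i)) =
    (\prod_(i in J) P (X i @^-1` B i))%E.

Definition gaussian_matrix (d : measure_display) (Omega : measurableType d)
    (R : realType) (P : probability Omega R) (r n : nat)
    (G : 'I_r -> 'I_n -> {RV P >-> R}) : Prop :=
  (forall i j (B : set R), measurable B -> distribution P (G i j) B = normal_prob 0 1 B) /\
  mutually_independent (fun ij : 'I_r * 'I_n => G ij.1 ij.2).

Definition rv_mx (d : measure_display) (Omega : measurableType d)
    (R : realType) (P : probability Omega R) (r n : nat)
    (G : 'I_r -> 'I_n -> {RV P >-> R}) (w : Omega) : 'M[R]_(r, n) :=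
  \matrix_(i, j) G i j w.

(* A has probability at least p.  When A is measurable this is p <= P A; for a
   set A that need not be measurable, it bounds the inner probability. *)
Definition prob_at_least (d : measure_display) (Omega : measurableType d)
    (R : realType) (P : probability Omega R) (A : set Omega) (p : R) : Prop :=
  exists E : set Omega, [/\ measurable E, E `<=` A & (p%:E <= P E)%E].

(* Main.v *)
Require Import Defs.
From HB Require Import structures.
From mathcomp Require Import all_boot all_order all_algebra.
From mathcomp Require Import all_classical all_reals all_analysis.
From mathcomp Require Import measurable_realfun zify ring lra.
Set Implicit Arguments.
Unset Strict Implicit.
Unset Printing Implicit Defensive.
Import Order.TTheory GRing.Theory Num.Theory.
Import numFieldNormedType.Exports.

Local Open Scope classical_set_scope.
Local Open Scope ring_scope.

(* Since [M - XY = CM] with [1 - C] the orthogonal projector onto the range of [MH],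
   the error is at most [sqrt (1 + |F|^2) |||Sigma_perp|||] for every right inverse
   [F] of [Q^T H], as soon as [H] has orthonormal columns; since the error depends on
   the range of [H] only, the full-rank case reduces to this one, and [kappa(H) >= 1].
   The matrix [F = (GH)^+ (GQ)] has [|F| <= |G| / sigma_min(GH)], so it suffices that
   [|G|^2 <= 9n/4] and [sigma_min(GH)^2 >= 9l/64] off small events.

   Both bounds come from a union bound over the integer points [z] with
   [|z|_1 <= 3r], of which there are at most [17^r] (only the lower bound for [r = 1]
   needs no net). Rounding a unit vector to the lattice [(4r)^(-1/2) Z^r] one
   coordinate at a time, always in the direction that favours a given quadratic form,
   raises the form by at most [1 / (16r)] times the sum of the positive parts of its
   diagonal entries: a loss far smaller than that of the usual net argument, which is
   what makes the constants fit. For fixed [z] the tails are Chernoff bounds, from the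
   formula [E exp((|g|^2 - g S g^T) / 2) = det(S)^(-1/2)], proved by integrating out
   one Gaussian variable at a time and passing to the Schur complement. *)

(** * Gaussian integrals and independence *)

(** The Radon-Nikodym derivative of the normal law equals [normal_pdf] almost everywhere, because
    both have the same integral over every measurable set. *)
Lemma ge0_integral_normal_prob (R : realType) (m s : R) (f : R -> \bar R) :
    measurable_fun [set: R] f -> (forall x, (0 <= f x)%E) ->
  (\int[normal_prob m s]_x f x =
   \int[lebesgue_measure]_x (f x * (normal_pdf m s x)%:E))%E.
Proof.
move=> mf f0.
rewrite -(@Radon_Nikodym_SigmaFinite.change_of_variables _ _ _ (normal_prob m s)
  lebesgue_measure (normal_prob_dominates m s))//.
have mpdf : measurable_fun [set: R] (fun x => (normal_pdf m s x)%:E).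
  by apply/measurable_EFinP; exact: measurable_normal_pdf.
have numu := normal_prob_dominates m s.
apply: ae_eq_integral => //.
- apply: emeasurable_funM => //.
  exact: (measurable_int _ (Radon_Nikodym_SigmaFinite.f_integrable numu)).
- exact: emeasurable_funM.
- apply: ae_eqe_mul2l; apply: integral_ae_eq => //.
  + exact: Radon_Nikodym_SigmaFinite.f_integrable.
  + by move=> E _ mE; rewrite -Radon_Nikodym_SigmaFinite.f_integral.
Qed.

(** Completing the square: multiplied by the standard normal density, the integrand is a constant
    times the normal density of mean [- q / p] and variance [p^-1], which integrates to 1. *)
Lemma normal_quad_mgf (R : realType) (p q : R) : 0 < p ->
  (\int[normal_prob 0 1]_x
     (expR (2^-1 * (x ^+ 2 - (p * x ^+ 2 + 2 * q * x))))%:E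
   = ((Num.sqrt p)^-1 * expR (q ^+ 2 / (2 * p)))%:E)%E.
Proof.
move=> p0.
have sp0 : 0 < Num.sqrt p by rewrite sqrtr_gt0.
have p_neq0 : p != 0 by rewrite gt_eqF.
rewrite ge0_integral_normal_prob; last first.
- by move=> x; rewrite lee_fin expR_ge0.
- apply/measurable_EFinP; apply: measurableT_comp => //.
  by do ?[apply: measurable_funM => //|apply: measurable_funB => //|
    apply: measurable_funD => //|apply: measurable_funX => //].
pose s := (Num.sqrt p)^-1.
have s0 : s != 0 by rewrite invr_eq0 gt_eqF.
have s2 : s ^+ 2 = p^-1 by rewrite exprVn sqr_sqrtr// ltW.
have pk : normal_peak (1 : R) = s * normal_peak s.
  rewrite /normal_peak s2 expr1n mul1r -mulrnAr sqrtrM ?invr_ge0 ?ltW//.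
  by rewrite invfM sqrtrV ?ltW// invrK mulKf// gt_eqF.
under eq_integral => x _.
  rewrite -EFinM normal_pdfE ?oner_eq0// pk /normal_fun.
  have -> : (expR (2^-1 * (x ^+ 2 - (p * x ^+ 2 + 2 * q * x))) *
    (s * normal_peak s * expR (- (x - 0) ^+ 2 / (1 ^+ 2 *+ 2)))) =
    (s * expR (q ^+ 2 / (2 * p))) * (normal_pdf (- q / p) s x).
    rewrite normal_pdfE// /normal_fun mulrCA -expRD -[RHS]mulrA.
    rewrite -[LHS]mulrA; congr (_ * _).
    rewrite [in RHS]mulrCA -expRD; congr (_ * expR _).
    rewrite s2; field.
    by rewrite p_neq0.
  rewrite EFinM.
  over.
rewrite ge0_integralZl_EFin//.
- by rewrite integral_normal_pdf mule1.
- by move=> x _; rewrite lee_fin normal_pdf_ge0.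
- by apply/measurable_EFinP; exact: measurable_normal_pdf.
- by rewrite mulr_ge0 ?expR_ge0// invr_ge0 sqrtr_ge0.
Qed.

Lemma mutually_independent_inj (d : measure_display) (Omega : measurableType d)
    (R : realType) (P : probability Omega R) (I J : finType)
    (X : I -> {RV P >-> R}) (f : J -> I) :
  injective f -> mutually_independent X ->
  mutually_independent (fun j => X (f j)).
Proof.
move=> finj hX K B mB.
pose B' i := if [pick j | f j == i] is Some j then B j else setT.
have B'f j : B' (f j) = B j.
  rewrite /B'; case: pickP => [k /eqP /finj -> //|/(_ j)]; by rewrite eqxx.
have mB' i : measurable (B' i) by rewrite /B'; case: pickP.
have := hX (f @: K)%SET B' mB'.
rewrite big_imset/=; last by move=> ? ? _ _ /finj.
under eq_bigr do rewrite B'f.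
move=> <-; congr (P _); apply/seteqP; split=> w /= H i /=.
- by move=> /imsetP[j jK ->]; rewrite /preimage/= B'f; exact: H.
- by move=> iK; have := H (f i); rewrite /preimage/= B'f; apply; exact: imset_f.
Qed.

Lemma mutually_independent_all (d : measure_display) (Omega : measurableType d)
    (R : realType) (P : probability Omega R) (I : finType)
    (X : I -> {RV P >-> R}) (B : I -> set R) :
  mutually_independent X -> (forall i, measurable (B i)) ->
  P [set w | forall i, B i (X i w)] = (\prod_i P (X i @^-1` B i))%E.
Proof.
move=> hX mB; have := hX [set: I]%SET B mB.
rewrite (eq_bigl xpredT) => [<-|i]; last by rewrite inE.
by congr (P _); apply/seteqP; split=> w /= h i; [move=> _|]; apply: h; rewrite /= ?inE.
Qed.

(** Measurable boxes. They are stable under intersection and generate the sigma-algebra on tuples,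
    so two finite measures that agree on them are equal. *)
Definition tuple_cylinder (R : realType) (N : nat) : set (set (N.-tuple R)) :=
  [set E | exists B : 'I_N -> set R,
    (forall i, measurable (B i)) /\ E = [set t | forall i, B i (tnth t i)]].

Lemma tuple_cylinder_measurable (R : realType) (N : nat) :
  @tuple_cylinder R N `<=` measurable.
Proof.
move=> _ [B [mB ->]].
rewrite (_ : [set _ | _] = \bigcap_(i in [set: 'I_N]) ((@tnth N R)^~ i @^-1` B i)).
  apply: fin_bigcap_measurable => // i _.
  by rewrite -[X in measurable X]setTI; apply: measurable_tnth.
by apply/seteqP; split=> t h i => [_|]; exact: h.
Qed.

Lemma measurable_tuple_cylinder (R : realType) (N : nat) :
  measurable `<=` <<s @tuple_cylinder R N >>.
Proof.
rewrite {1}/measurable/=; apply: smallest_sub; first exact: smallest_sigma_algebra.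
rewrite -bigcup_seq => _ [i _ [A mA <-]]; rewrite setTI.
apply: sub_sigma_algebra; exists (fun j => if j == i then A else setT); split.
  by move=> j; case: ifP.
apply/seteqP; split=> t /=; last by move=> /(_ i); rewrite eqxx.
by move=> At j; case: eqP => // ->.
Qed.

(** Mutual independence only speaks of boxes. For fixed [A], however, both sides are finite measures
    in [E] that agree on boxes, hence everywhere. *)
Lemma preimage_tuple_law (d : measure_display) (Omega : measurableType d)
    (R : realType) (P : probability Omega R) (N : nat)
    (X : 'I_N.+1 -> {RV P >-> R}) (Z : {mfun Omega >-> N.-tuple R})
    (A : set R) (E : set (N.-tuple R)) :
  mutually_independent X -> (forall w i, tnth (Z w) i = X (lift ord0 i) w) ->
  measurable A -> measurable E ->
  P (X ord0 @^-1` A `&` Z @^-1` E) = (P (X ord0 @^-1` A) * P (Z @^-1` E))%E.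
Proof.
move=> hX ZE mA mE.
have mXA : measurable (X ord0 @^-1` A) by exact: measurable_funPTI.
pose c := fine (P (X ord0 @^-1` A)).
have c0 : 0 <= c by rewrite fine_ge0.
have cE : c%:E = P (X ord0 @^-1` A) by rewrite fineK// fin_num_measure.
pose m1 := pushforward (mrestr P mXA) Z.
pose m2 := mscale (NngNum c0) (distribution P Z).
suff : m1 E = m2 E.
  rewrite /m1 /m2 /pushforward /mrestr /mscale/= /distribution /pushforward /=.
  by rewrite setIC => ->; rewrite cE.
apply: (@g_sigma_algebra_measure_unique _ _ _ (@tuple_cylinder R N) _ (fun=> setT)) => //.
- exact: tuple_cylinder_measurable.
- by move=> _; exists (fun=> setT); split=> //; apply/seteqP; split.
- by rewrite bigcup_const.
- move=> _ _ [B1 [mB1 ->]] [B2 [mB2 ->]]; exists (fun i => B1 i `&` B2 i).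
  split=> [i|]; first exact: measurableI.
  by apply/seteqP; split=> [t [h1 h2] i|t h]//=; split=> i; have [] := h i.
- move=> _ [B [mB ->]].
  set D := [set t | _].
  change (P (Z @^-1` D `&` X ord0 @^-1` A) = c%:E * P (Z @^-1` D))%E.
  rewrite cE.
  (* A box with [N] factors becomes one with [N.+1] factors, [A] in front. *)
  pose B' i := oapp B A (unlift ord0 i).
  have mB' i : measurable (B' i) by rewrite /B'; case: unlift.
  have B'0 : B' ord0 = A by rewrite /B' unlift_none.
  have B'l i : B' (lift ord0 i) = B i by rewrite /B' liftK.
  have := mutually_independent_all hX mB'; rewrite big_ord_recl B'0.
  under eq_bigr do rewrite B'l.
  have hXl := mutually_independent_inj (@lift_inj _ ord0) hX.
  rewrite -(mutually_independent_all hXl mB) => H.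
  transitivity (P [set w | forall i, B' i (X i w)]).
    congr (P _); apply/seteqP; split=> w /=.
    + move=> [h1 h2] i; case: (unliftP ord0 i) => [j ->|->]; rewrite ?B'0 ?B'l//.
      by rewrite -ZE; exact: h1.
    + move=> h; split; last by rewrite /preimage/= -B'0.
      by move=> i /=; rewrite ZE -B'l.
  rewrite H; congr (_ * P _)%E.
  by apply/seteqP; split=> w /= h i; [rewrite ZE|rewrite -ZE]; exact: h.
- move=> _; change (P (Z @^-1` setT `&` X ord0 @^-1` A) < +oo)%E.
  by rewrite preimage_setT setTI (le_lt_trans (probability_le1 _ _)) ?ltry.
- exact: measurable_tuple_cylinder.
Qed.

(** The joint law of [X ord0] and [Z] is the product of their laws, by uniqueness of the product
    measure, so Tonelli allows the first variable to be integrated out with the others fixed. *)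
Lemma ge0_integral_indep (d : measure_display) (Omega : measurableType d)
    (R : realType) (P : probability Omega R) (N : nat)
    (X : 'I_N.+1 -> {RV P >-> R}) (Z : {mfun Omega >-> N.-tuple R})
    (f : R * N.-tuple R -> \bar R) :
  mutually_independent X -> (forall w i, tnth (Z w) i = X (lift ord0 i) w) ->
  measurable_fun [set: R * N.-tuple R] f -> (forall z, (0 <= f z)%E) ->
  (\int[P]_w f (X ord0 w, Z w) =
   \int[P]_w \int[distribution P (X ord0)]_x f (x, Z w))%E.
Proof.
move=> hX ZE mf f0.
have mXZ : measurable_fun [set: Omega] (fun w => (X ord0 w, Z w)).
  by apply/measurable_fun_pair => //=; exact: measurable_funP.
pose XZ : {mfun Omega >-> (R * N.-tuple R)%type} :=
  HB.pack (fun w => (X ord0 w, Z w)) (isMeasurableFun.Build _ _ _ _ _ mXZ).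
transitivity (\int[distribution P XZ]_z f z)%E.
  by rewrite ge0_integral_distribution.
transitivity (\int[(distribution P (X ord0) \x distribution P Z)%E]_z f z)%E.
  apply: eq_measure_integral => E mE _; apply/esym.
  apply: (@product_measure_unique _ _ _ _ R (distribution P (X ord0))
    (distribution P Z) (distribution P XZ)) => // A B mA mB.
  exact: (preimage_tuple_law hX ZE mA mB).
rewrite fubini_tonelli2//= ge0_integral_distribution//.
- exact: measurable_fun_fubini_tonelli_G.
- by move=> y; apply: integral_ge0.
Qed.

(** * Exponential moments of Gaussian quadratic forms *)

Lemma measurable_quad (d : measure_display) (T : measurableType d) (R : realType)
    (k N : nat) (S : 'M[R]_N) (x : T -> 'M[R]_(k, N)) i j :
  (forall i j, measurable_fun [set: T] (fun w => x w i j)) ->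
  measurable_fun [set: T] (fun w => (x w *m S *m (x w)^T) i j).
Proof.
move=> mx.
rewrite (_ : (fun _ => _) = fun w => \sum_b (\sum_a x w i a * S a b) * x w j b); last first.
  apply/funext => w; rewrite mxE; apply: eq_bigr => b _; rewrite !mxE.
  by congr (_ * _).
apply: measurable_sum => b; apply: measurable_funM => //.
by apply: measurable_sum => a; apply: measurable_funM.
Qed.

Lemma sqn_row_mx (R : realType) (N : nat) (a : R) (z : 'rV[R]_N) :
  (row_mx a%:M z *m (row_mx a%:M z)^T) 0 0 = a ^+ 2 + (z *m z^T) 0 0.
Proof.
rewrite tr_row_mx mul_row_col tr_scalar_mx -scalar_mxM [LHS]mxE.
by rewrite [_%:M 0 0]mxE mulr1n expr2.
Qed.

Definition posdef (R : realType) (N : nat) (S : 'M[R]_N) :=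
  S^T = S /\ forall x : 'rV[R]_N, x != 0 -> 0 < (x *m S *m x^T) 0 0.

Section schur.
Variables (R : realType) (N : nat) (S : 'M[R]_(1 + N)).
Hypothesis SP : posdef S.
Let p := S 0 0.
Let q : 'rV[R]_N := ursubmx S.

Definition schur_compl : 'M[R]_N := drsubmx S - p^-1 *: (q^T *m q).

Lemma schur_block : S = block_mx p%:M q q^T (drsubmx S).
Proof.
rewrite -[LHS]submxK; congr block_mx.
  by apply/matrixP => i j; rewrite !ord1 !mxE/= mulr1n; congr (S _ _); apply/val_inj.
by rewrite -[in LHS](SP.1) /q trmx_ursub.
Qed.

Lemma quad_row_mx (a : R) (z : 'rV[R]_N) :
  (row_mx a%:M z *m S *m (row_mx a%:M z)^T) 0 0 =
  p * a ^+ 2 + 2 * (q *m z^T) 0 0 * a + (z *m drsubmx S *m z^T) 0 0.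
Proof.
rewrite {1}schur_block mul_row_block tr_row_mx mul_row_col.
have qz : z *m q^T = (q *m z^T)^T by rewrite trmx_mul trmxK.
rewrite tr_scalar_mx !mulmxDl qz -!mulmxA !mul_scalar_mx !mul_mx_scalar.
rewrite !mxE !mulr1n.
ring.
Qed.

Lemma schur_pivot_gt0 : 0 < p.
Proof.
have := SP.2 (row_mx 1%:M 0).
rewrite quad_row_mx trmx0 mulmx0 mxE mulr0 mul0r expr1n mulr1 !addr0 mul0mx mulmx0.
rewrite mxE addr0; apply.
by apply/eqP => /rowP/(_ 0)/eqP; rewrite !mxE/= split1 unlift_none/= mxE oner_eq0.
Qed.

(** For positive [p] this is the minimum over [a] of the form in [quad_row_mx]. *)
Lemma quad_schur (z : 'rV[R]_N) :
  (z *m schur_compl *m z^T) 0 0 =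
  (z *m drsubmx S *m z^T) 0 0 - (q *m z^T) 0 0 ^+ 2 / p.
Proof.
rewrite /schur_compl mulmxBr mulmxBl [LHS]mxE [X in _ + X]mxE; congr (_ - _).
rewrite -scalemxAr -scalemxAl [LHS]mxE mulrC; congr (_ / _).
have qz : z *m q^T = (q *m z^T)^T by rewrite trmx_mul trmxK.
by rewrite mulmxA qz -mulmxA [LHS]mxE big_ord1 [_^T _ _]mxE expr2.
Qed.

Lemma schur_posdef : posdef schur_compl.
Proof.
have p0 := schur_pivot_gt0.
split.
  rewrite /schur_compl linearB/= linearZ/= trmx_mul trmxK.
  by rewrite trmx_drsub SP.1.
move=> z z0; rewrite quad_schur.
(* The first coordinate is the minimizer, at which the form of [S] takes the value of the form of
   the Schur complement. *)
have := SP.2 (row_mx (- (q *m z^T) 0 0 / p)%:M z).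
rewrite quad_row_mx.
set c := (q *m z^T) 0 0; set e := (z *m _ *m _) 0 0.
have -> : p * (- c / p) ^+ 2 + 2 * c * (- c / p) + e = e - c ^+ 2 / p.
  by field; rewrite gt_eqF.
apply; apply/eqP => H; move/eqP: z0; apply.
by have := congr1 rsubmx H; rewrite row_mxKr linear0.
Qed.

Lemma det_schur : \det S = p * \det schur_compl.
Proof.
have p0 := schur_pivot_gt0.
have -> : S = block_mx 1%:M 0 (p^-1 *: q^T) 1%:M *m
              block_mx p%:M q 0 schur_compl.
  rewrite mulmx_block !mul1mx !mul0mx !addr0 {1}schur_block; congr block_mx.
    by rewrite mul_mx_scalar scalerA mulfV ?scale1r// gt_eqF.
  by rewrite -scalemxAl /schur_compl addrC subrK.
by rewrite det_mulmx det_lblock det_ublock !det1 !mul1r det_scalar1.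
Qed.

End schur.

(* [normal_prob] lives on the copy [measurableTypeR R] of [R], whose display
   differs from that of [R]; the two are bridged by pushing forward along id. *)
Lemma integral_standard_normal (d : measure_display) (Omega : measurableType d)
    (R : realType) (P : probability Omega R) (X : {RV P >-> R}) (f : R -> \bar R) :
  (forall B : set R, measurable B -> distribution P X B = normal_prob 0 1 B) ->
  measurable_fun [set: R] f -> (forall y, (0 <= f y)%E) ->
  (\int[distribution P X]_x f x = \int[normal_prob 0 1]_x f x)%E.
Proof.
move=> gX mf f0.
have mid : measurable_fun [set: measurableTypeR R] (idfun : measurableTypeR R -> R).
  exact: measurable_id.
pose idTR : {mfun measurableTypeR R >-> R} :=
  HB.pack (idfun : measurableTypeR R -> R) (isMeasurableFun.Build _ _ _ _ _ mid).
transitivity (\int[distribution (normal_prob 0 1) idTR]_x f x)%E.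
  by apply: eq_measure_integral => A mA _; exact: gX.
by rewrite ge0_integral_distribution.
Qed.

(** Induction on [N]. With the other variables fixed, [normal_quad_mgf] evaluates the integral over
    the first one: it contributes [(Num.sqrt p)^-1] and turns the remaining exponent into the one
    for the Schur complement. Then [det_schur] collects the factors. *)
Lemma gauss_quad_mgf (d : measure_display) (Omega : measurableType d)
    (R : realType) (P : probability Omega R) (N : nat)
    (X : 'I_N -> {RV P >-> R}) (S : 'M[R]_N) :
  (forall i (B : set R), measurable B ->
     distribution P (X i) B = normal_prob 0 1 B) ->
  mutually_independent X -> posdef S ->
  let x w := \row_i X i w in
  0 < \det S /\
  (\int[P]_w (expR (2^-1 * ((x w *m (x w)^T) 0 0 - (x w *m S *m (x w)^T) 0 0)))%:E
   = ((Num.sqrt (\det S))^-1)%:E)%E.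
Proof.
elim: N => [|N IH] in X S *; move=> gX hX SP x.
  rewrite det_mx00 ltr01 sqrtr1 invr1; split=> //.
  under eq_integral.
    move=> w _; rewrite [x w]thinmx0 !mul0mx subrr mulr0 expR0; over.
  rewrite integral_cst //= ?mul1e; by rewrite probability_setT.
set p := S 0 0.
have p0 : 0 < p := schur_pivot_gt0 SP.
pose X' i := X (lift ord0 i).
have hX' : mutually_independent X' := mutually_independent_inj (@lift_inj _ ord0) hX.
have [det0 intS] := IH X' (schur_compl S) (fun i => gX _) hX' (schur_posdef SP).
split; first by rewrite (det_schur SP) mulr_gt0.
have mZ : measurable_fun [set: Omega] (fun w => [tuple X' i w | i < N]).
  apply/measurable_fun_tnthP => i.
  rewrite (_ : _ \o _ = X' i)//; last by apply/funext => w /=; rewrite tnth_mktuple.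
pose Z : {mfun Omega >-> N.-tuple R} := HB.pack (fun w => [tuple X' i w | i < N])
  (isMeasurableFun.Build _ _ _ _ _ mZ).
have ZE w i : tnth (Z w) i = X (lift ord0 i) w by rewrite tnth_mktuple.
pose q : 'rV[R]_N := ursubmx (S : 'M[R]_(1 + N)).
pose r (t : N.-tuple R) : 'rV[R]_N := \row_i tnth t i.
pose e (t : N.-tuple R) := (r t *m (r t)^T) 0 0 -
  (r t *m drsubmx (S : 'M[R]_(1 + N)) *m (r t)^T) 0 0.
(* The integrand as a function of the first variable [z.1] and of the others [z.2]; [e] gathers the
   terms free of the first variable. *)
pose g (z : R * N.-tuple R) := expR (2^-1 * (z.1 ^+ 2 -
  (p * z.1 ^+ 2 + 2 * (q *m (r z.2)^T) 0 0 * z.1)) + 2^-1 * e z.2).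
have mr i j : measurable_fun [set: R * N.-tuple R] (fun z => r z.2 i j).
  rewrite /r; under eq_fun do rewrite mxE.
  exact: (measurableT_comp (measurable_tnth j) measurable_snd).
have mqr : measurable_fun [set: R * N.-tuple R] (fun z => (q *m (r z.2)^T) 0 0).
  rewrite (_ : (fun _ => _) = fun z => \sum_b q 0 b * r z.2 0 b); last first.
    by apply/funext => z; rewrite mxE; apply: eq_bigr => b _; rewrite !mxE.
  by apply: measurable_sum => b; apply: measurable_funM.
have mg : measurable_fun setT g.
  apply: measurableT_comp => //; apply: measurable_funD.
    apply: measurable_funM => //; apply: measurable_funB; first exact: measurable_funX.
    apply: measurable_funD; apply: measurable_funM => //; first exact: measurable_funX.
    exact: measurable_funM.
  apply: measurable_funM => //; apply: measurable_funB; last exact: measurable_quad.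
  have := measurable_quad 1%:M 0 0 mr; under eq_fun do rewrite mulmx1.
  exact.
have xE w : x w = row_mx (X ord0 w)%:M (r (Z w)).
  apply/rowP => i; rewrite !mxE; case: split_ordP => j -> /=.
    by rewrite ord1 mxE eqxx mulr1n; congr (X _ w); apply/val_inj.
  by rewrite mxE ZE; congr (X _ w); apply/val_inj.
transitivity (\int[P]_w (g (X ord0 w, Z w))%:E)%E.
  apply: eq_integral => w _; congr (expR _)%:E.
  rewrite xE quad_row_mx//= sqn_row_mx /e -/p -/q.
  ring.
rewrite (ge0_integral_indep hX (Z := Z) (f := fun z => (g z)%:E))//; last 2 first.
- exact/measurable_EFinP.
- by move=> z; rewrite lee_fin expR_ge0.
have gE (f : R -> \bar R) : measurable_fun [set: R] f -> (forall y, (0 <= f y)%E) ->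
    (\int[distribution P (X ord0)]_x f x = \int[normal_prob 0 1]_x f x)%E.
  by apply: integral_standard_normal => B mB; exact: gX.
transitivity (\int[P]_w ((Num.sqrt p)^-1%:E * (expR (2^-1 *
    ((\row_i X' i w *m (\row_i X' i w)^T) 0 0 -
     (\row_i X' i w *m schur_compl S *m (\row_i X' i w)^T) 0 0)))%:E))%E.
  apply: eq_integral => w _; rewrite gE; last 2 first.
  - apply/measurable_EFinP; apply: measurableT_comp mg _.
    exact/measurable_fun_pair.
  - by move=> z; rewrite lee_fin expR_ge0.
  rewrite /g/=; under eq_integral do rewrite expRD EFinM.
  rewrite ge0_integralZr//; last first.
  - apply/measurable_EFinP; apply: measurableT_comp => //.
    by do ?[apply: measurable_funM => //|apply: measurable_funB => //|
      apply: measurable_funD => //|apply: measurable_funX => //].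
  rewrite normal_quad_mgf// -!EFinM -mulrA -expRD; congr (_ * expR _)%:E.
  have -> : \row_i X' i w = r (Z w) by apply/rowP => i; rewrite !mxE ZE.
  rewrite quad_schur /e -/p -/q; field.
  by rewrite gt_eqF.
rewrite ge0_integralZl_EFin//; last first.
- have mX' i j : measurable_fun [set: Omega] (fun w => (\row_i X' i w) i j).
    by under eq_fun do rewrite mxE; exact: measurable_funP.
  apply/measurable_EFinP; apply: measurableT_comp => //.
  apply: measurable_funM => //; apply: measurable_funB; last exact: measurable_quad.
  have := measurable_quad 1%:M 0 0 mX'; under eq_fun do rewrite mulmx1.
  exact.
rewrite intS -EFinM; congr _%:E.
by rewrite (det_schur SP) sqrtrM ?ltW// invfM.
Qed.

(** * Chernoff bounds for compressed Gaussian matrices *)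

(** The square of [frobenius_norm], which keeps square roots out of the computations; on vectors it
    is the squared Euclidean norm. *)
Definition fro2 (R : realType) (p q : nat) (A : 'M[R]_(p, q)) : R :=
  \sum_i \sum_j A i j ^+ 2.

Lemma fro2_row (R : realType) (q : nat) (x : 'rV[R]_q) : (x *m x^T) 0 0 = fro2 x.
Proof. by rewrite /fro2 big_ord1 mxE; apply: eq_bigr => j _; rewrite mxE expr2. Qed.

Lemma fro2_ge0 (R : realType) (p q : nat) (A : 'M[R]_(p, q)) : 0 <= fro2 A.
Proof. by apply: sumr_ge0 => i _; apply: sumr_ge0 => j _; exact: sqr_ge0. Qed.

Lemma fro2_eq0 (R : realType) (p q : nat) (A : 'M[R]_(p, q)) : (fro2 A == 0) = (A == 0).
Proof.
apply/eqP/eqP => [|->]; last first.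
  by rewrite /fro2 big1// => i _; rewrite big1// => j _; rewrite mxE expr0n.
move/eqP; rewrite psumr_eq0 => [/allP A0|i _]; last first.
  by apply: sumr_ge0 => j _; exact: sqr_ge0.
apply/matrixP => i j; rewrite mxE; have := A0 i (mem_index_enum i).
rewrite psumr_eq0 => [/allP /(_ j (mem_index_enum j))|k _]; last exact: sqr_ge0.
by rewrite sqrf_eq0 => /eqP.
Qed.

(** The defect is the squared length of [x - x A A^T], the component of [x] orthogonal to the
    columns of [A]. *)
Lemma bessel (R : realType) (N l : nat) (A : 'M[R]_(N, l)) (x : 'rV[R]_N) :
  orthonormal_cols A -> fro2 (x *m A) <= fro2 x.
Proof.
move=> hA; rewrite -subr_ge0.
suff -> : fro2 x - fro2 (x *m A) = fro2 (x - x *m A *m A^T) by exact: fro2_ge0.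
rewrite -!fro2_row linearB/= mulmxBl !mulmxBr !trmx_mul trmxK -!mulmxA.
rewrite (mulmxA A^T A) hA mul1mx !mulmxA subrr subr0 [RHS]mxE.
by rewrite [X in _ = _ + X]mxE.
Qed.

(** Sylvester's determinant identity, read off from two triangular factorizations of one block
    matrix. *)
Lemma det_1subM (R : realType) (N l : nat) (A : 'M[R]_(N, l)) (B : 'M[R]_(l, N)) :
  \det (1%:M - A *m B) = \det (1%:M - B *m A).
Proof.
have e1 : block_mx 1%:M A B 1%:M =
    block_mx 1%:M A 0 1%:M *m block_mx (1%:M - A *m B) 0 B 1%:M.
  by rewrite mulmx_block !mul1mx !mul0mx !mulmx1 !add0r subrK.
have e2 : block_mx 1%:M A B 1%:M =
    block_mx 1%:M 0 B 1%:M *m block_mx 1%:M A 0 (1%:M - B *m A).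
  by rewrite mulmx_block !mul1mx !mul0mx !mulmx1 !addr0 addrC subrK.
have := congr1 determinant e1; rewrite e2 !det_mulmx.
by rewrite !(det_ublock, det_lblock) !det1 !(mul1r, mulr1).
Qed.

(** The matrix acts as [c] on the [l]-dimensional range of [A] and as the identity on its orthogonal
    complement. *)
Lemma det_1subZgram (R : realType) (N l : nat) (A : 'M[R]_(N, l)) (c : R) :
  orthonormal_cols A -> \det (1%:M - (1 - c) *: (A *m A^T)) = c ^+ l.
Proof.
move=> hA; rewrite scalemxAl det_1subM -scalemxAr hA.
rewrite (_ : _ - _ = c%:M) ?det_scalar//.
by apply/matrixP => i j; rewrite !mxE; case: (i == j); rewrite ?mulr1n ?mulr0n; ring.
Qed.

Lemma quad_1subZgram (R : realType) (N l : nat) (A : 'M[R]_(N, l)) (x : 'rV[R]_N) (a : R) :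
  (x *m (1%:M - a *: (A *m A^T)) *m x^T) 0 0 = fro2 x - a * fro2 (x *m A).
Proof.
rewrite mulmxBr mulmx1 mulmxBl -scalemxAr -scalemxAl -!fro2_row.
by rewrite [LHS]mxE [X in _ + X]mxE [X in _ - X]mxE trmx_mul !mulmxA.
Qed.

Lemma posdef_1subZgram (R : realType) (N l : nat) (A : 'M[R]_(N, l)) (c : R) :
  0 < c -> orthonormal_cols A -> posdef (1%:M - (1 - c) *: (A *m A^T)).
Proof.
move=> c0 hA; split; first by rewrite linearB/= linearZ/= trmx_mul trmxK trmx1.
move=> x x0.
rewrite quad_1subZgram.
have fx0 : 0 < fro2 x by rewrite lt_neqAle fro2_ge0 eq_sym fro2_eq0 x0.
have := bessel x hA; have := fro2_ge0 (x *m A).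
(* For [c <= 1] the form is at least [c * fro2 x] by [bessel]; for [c > 1] it is at least
   [fro2 x]. *)
by case: (leP c 1) => ?; nra.
Qed.

(** The inverse of [mxvec_index]. It lists the entries of a matrix as one vector, to which
    [gauss_quad_mgf] applies. *)
Definition vec_pair (r n : nat) (k : 'I_(r * n)) : 'I_r * 'I_n :=
  enum_val (cast_ord (esym (mxvec_cast r n)) k).

Lemma mxvec_indexK (r n : nat) :
  cancel (fun p : 'I_r * 'I_n => mxvec_index p.1 p.2) (@vec_pair r n).
Proof. by case=> i j; rewrite /vec_pair /mxvec_index cast_ordK enum_rankK. Qed.

Lemma vec_pair_inj (r n : nat) : injective (@vec_pair r n).
Proof. by move=> k k' /enum_val_inj /cast_ord_inj. Qed.

Lemma sum_vec_pair (R : realType) (r n : nat) (F : 'I_r -> 'I_n -> R) :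
  \sum_(k < r * n) F (vec_pair k).1 (vec_pair k).2 = \sum_i \sum_j F i j.
Proof.
rewrite pair_big/= (reindex (fun p : 'I_r * 'I_n => mxvec_index p.1 p.2))/=.
  by apply: eq_bigr => p _; rewrite mxvec_indexK.
apply: onW_bij; exists (@vec_pair r n); first exact: mxvec_indexK.
by move=> k; apply: vec_pair_inj; rewrite mxvec_indexK.
Qed.

Section gauss_compress.
Variables (d : measure_display) (Omega : measurableType d) (R : realType).
Variables (P : probability Omega R) (r n : nat) (G : 'I_r -> 'I_n -> {RV P >-> R}).
Hypothesis hG : gaussian_matrix G.
Variables (s l : nat) (B : 'M[R]_(r, s)) (H : 'M[R]_(n, l)).
Hypotheses (hB : orthonormal_cols B) (hH : orthonormal_cols H).

(** The Kronecker product of [B] and [H]: it sends the list of entries of [G] to that of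
    [B^T G H]. *)
Let A : 'M[R]_(r * n, s * l) := \matrix_(k, t)
  (B (vec_pair k).1 (vec_pair t).1 * H (vec_pair k).2 (vec_pair t).2).

Let x w : 'rV[R]_(r * n) := \row_k G (vec_pair k).1 (vec_pair k).2 w.

Let orthonormalA : orthonormal_cols A.
Proof.
apply/matrixP => t t'; rewrite !mxE.
under eq_bigr do rewrite !mxE.
rewrite (sum_vec_pair (fun i j => B i (vec_pair t).1 * H j (vec_pair t).2 *
  (B i (vec_pair t').1 * H j (vec_pair t').2))).
have : (B^T *m B) (vec_pair t).1 (vec_pair t').1 *
       (H^T *m H) (vec_pair t).2 (vec_pair t').2 = (t == t')%:R.
  rewrite hB hH !mxE -natrM mulnb -(inj_eq (@vec_pair_inj _ _)).
  by case: (vec_pair t) => ? ?; case: (vec_pair t') => ? ?.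
move=> <-; rewrite !mxE big_distrl/=; apply: eq_bigr => i _.
rewrite big_distrr/=; apply: eq_bigr => j _; rewrite !mxE.
ring.
Qed.

Let fro2_xA w : fro2 (x w *m A) = fro2 (B^T *m rv_mx G w *m H).
Proof.
rewrite {1}/fro2 big_ord1 /fro2 -sum_vec_pair; apply: eq_bigr => t _.
congr (_ ^+ 2); rewrite !mxE.
under eq_bigr do rewrite !mxE.
rewrite (sum_vec_pair (fun i j => G i j w *
  (B i (vec_pair t).1 * H j (vec_pair t).2))) exchange_big/=.
apply: eq_bigr => j _; rewrite !mxE big_distrl/=; apply: eq_bigr => i _.
rewrite !mxE; ring.
Qed.

Lemma measurable_fro2_compress :
  measurable_fun [set: Omega] (fun w => fro2 (B^T *m rv_mx G w *m H)).
Proof.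
apply: measurable_sum => a; apply: measurable_sum => b; apply: measurable_funX.
under eq_fun do rewrite mxE.
apply: measurable_sum => j; apply: measurable_funM => //.
under eq_fun do rewrite mxE.
apply: measurable_sum => i; apply: measurable_funM => //.
by under eq_fun do rewrite mxE; exact: measurable_funP.
Qed.

(** This is [gauss_quad_mgf] for [S = 1 - (1 - c) A A^T]: the difference of the two forms is
    [(1 - c) |x A|^2], and the determinant is [c ^+ (s * l)]. *)
Lemma gauss_compress_mgf (c : R) : 0 < c ->
  (\int[P]_w (expR (2^-1 * (1 - c) * fro2 (B^T *m rv_mx G w *m H)))%:E =
   ((Num.sqrt (c ^+ (s * l)))^-1)%:E)%E.
Proof.
move=> c0; have [gG iG] := hG.
have [] := @gauss_quad_mgf _ _ _ P (r * n)
  (fun k => G (vec_pair k).1 (vec_pair k).2) (1%:M - (1 - c) *: (A *m A^T))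
  (fun k => gG _ _) (mutually_independent_inj (@vec_pair_inj r n) iG)
  (posdef_1subZgram c0 orthonormalA).
rewrite det_1subZgram// => _ <-; apply: eq_integral => w _.
congr (expR _)%:E; rewrite -fro2_xA -/(x w) -mulrA; congr (_ * _).
by rewrite quad_1subZgram fro2_row subKr.
Qed.

(** Markov's inequality for the exponential moment. The factor [1 - c] on both sides covers both
    tails: the event is that of large values when [c < 1] and of small values when [c > 1]. *)
Lemma gauss_compress_chernoff (c t : R) : 0 < c ->
  (P [set w | ((1 - c) * t <= (1 - c) * fro2 (B^T *m rv_mx G w *m H))%R] <=
   ((Num.sqrt (c ^+ (s * l)))^-1 * expR (- (2^-1 * (1 - c) * t)))%:E)%E.
Proof.
move=> c0; rewrite EFinM -gauss_compress_mgf//.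
set f := fun w => fro2 (B^T *m rv_mx G w *m H).
have mf : measurable_fun [set: Omega] f := measurable_fro2_compress.
have mE : measurable [set w | (1 - c) * t <= (1 - c) * f w].
  rewrite -[X in measurable X]setTI.
  by apply: measurable_fun_le => //; exact: measurable_funM.
have me : measurable_fun [set: Omega] (fun w => (expR (2^-1 * (1 - c) * f w))%:E).
  apply/measurable_EFinP; apply: measurableT_comp => //; exact: measurable_funM.
rewrite -ge0_integralZr//.
have -> : P [set w | ((1 - c) * t <= (1 - c) * f w)%R] =
    (\int[P]_w (\1_[set w | (1 - c) * t <= (1 - c) * f w] w)%:E)%E.
  by rewrite integral_indic// setIT.
apply: ge0_le_integral => //.
- by apply/measurable_EFinP; exact: measurable_indic.
- exact: emeasurable_funM.
- move=> w _; rewrite -EFinM -expRD lee_fin indicE.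
  have [|_] := boolP (w \in _); last exact: expR_ge0.
  rewrite inE/= => h; rewrite -[leLHS]expR0 ler_expR -/(f w); lra.
Qed.

End gauss_compress.

(** * Rounding quadratic forms to a lattice *)

Definition quad (R : realType) (r : nat) (B : 'M[R]_r) (x : 'rV[R]_r) : R :=
  (x *m B *m x^T) 0 0.

Lemma quadDZ (R : realType) (r : nat) (B : 'M[R]_r) (x : 'rV[R]_r) (i : 'I_r) (t : R) :
  quad B (x + t *: delta_mx 0 i) =
  quad B x + t * ((x *m (B + B^T)) 0 i) + t ^+ 2 * B i i.
Proof.
pose d : 'rV[R]_r := delta_mx 0 i; rewrite -/d.
have e1 : (x *m B *m d^T) 0 0 = (x *m B) 0 i.
  by rewrite trmx_delta -colE mxE.
have e2 : (d *m B *m x^T) 0 0 = (x *m B^T) 0 i.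
  by rewrite -rowE !mxE; apply: eq_bigr => j _; rewrite !mxE mulrC.
have e3 : (d *m B *m d^T) 0 0 = B i i.
  by rewrite trmx_delta -colE -rowE !mxE.
have split4 (a b c f : 'M[R]_1) : (a + b + (c + f)) 0 0 = a 0 0 + b 0 0 + (c 0 0 + f 0 0).
  by rewrite !mxE.
rewrite /quad linearD linearZ/= !mulmxDl !mulmxDr -!scalemxAl -!scalemxAr split4.
have scal a (M : 'M[R]_1) : (a *: M) 0 0 = a * M 0 0 by rewrite mxE.
rewrite !scal e1 e2 e3 [X in _ = _ + _ * X + _]mxE.
ring.
Qed.

(** Give [t1] and [t2] the weights [t2] and [- t1]. The linear terms cancel, so the weighted mean of
    the two increments is [- t1 * t2 * B i i]. Since [- t1 * t2 <= (t2 - t1)^2 / 4], one of the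
    increments is within the bound. *)
Lemma quad_round1 (R : realType) (r : nat) (B : 'M[R]_r) (x : 'rV[R]_r) (i : 'I_r)
    (t1 t2 D : R) : t1 <= 0 -> 0 < t2 -> 0 <= D -> B i i <= D ->
  exists2 t, t = t1 \/ t = t2 &
    quad B (x + t *: delta_mx 0 i) <= quad B x + (t2 - t1) ^+ 2 / 4 * D.
Proof.
move=> t10 t20 D0 BD.
set L := (x *m (B + B^T)) 0 i.
have key : t2 * (t1 * L + t1 ^+ 2 * B i i) - t1 * (t2 * L + t2 ^+ 2 * B i i) <=
    (t2 - t1) * ((t2 - t1) ^+ 2 / 4 * D).
  have -> : t2 * (t1 * L + t1 ^+ 2 * B i i) - t1 * (t2 * L + t2 ^+ 2 * B i i) =
    (t2 - t1) * (- (t1 * t2) * B i i) by ring.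
  apply: ler_wpM2l; first lra.
  have h0 : 0 <= - (t1 * t2) by nra.
  apply: (@le_trans _ _ (- (t1 * t2) * D)); first exact: ler_wpM2l.
  apply: ler_wpM2r => //; have := sqr_ge0 (t2 + t1); lra.
set E := (t2 - t1) ^+ 2 / 4 * D in key *.
have [h|h] := leP (t1 * L + t1 ^+ 2 * B i i) E.
  by exists t1; [left|rewrite quadDZ -/L -addrA lerD2l].
exists t2; [by right|rewrite quadDZ -/L -addrA lerD2l].
set A1 := t1 * L + _ in h key; set A2 := t2 * L + _ in key *.
rewrite leNgt; apply/negP => h2.
have h3 : 0 < t2 * (A1 - E) by rewrite mulr_gt0// subr_gt0.
have h4 : 0 <= - t1 * (A2 - E) by rewrite mulr_ge0 ?oppr_ge0// subr_ge0 ltW.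
lra.
Qed.

(** Each coordinate moves to one of two consecutive multiples of [e]. The loss given by
    [quad_round1] with [t2 - t1 = e] does not depend on how the earlier coordinates were rounded, so
    the losses add up. *)
Lemma quad_round (R : realType) (r : nat) (B : 'M[R]_r) (u : 'rV[R]_r) (e : R)
    (D : 'I_r -> R) : 0 < e -> (forall i, 0 <= D i) -> (forall i, B i i <= D i) ->
  exists z : 'I_r -> int,
    (forall i, `|(z i)%:~R| <= `|u 0 i| / e + 1) /\
    quad B (\row_i (e * (z i)%:~R)) <= quad B u + e ^+ 2 / 4 * \sum_i D i.
Proof.
move=> e0 D0 BD.
(* After [k] steps the first [k] coordinates are rounded and the others are still those of [u]. *)
suff H k : (k <= r)%N -> exists z : 'I_r -> int,
    (forall i, `|(z i)%:~R| <= `|u 0 i| / e + 1) /\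
    quad B (\row_i (if (i < k)%N then e * (z i)%:~R else u 0 i)) <=
      quad B u + e ^+ 2 / 4 * \sum_(i < r | (i < k)%N) D i.
  have [z [hz hQ]] := H r (leqnn r); exists z; split=> //.
  rewrite (eq_bigl xpredT) in hQ; last by move=> i; rewrite ltn_ord.
  rewrite [X in quad B X](_ : _ = \row_i (if (i < r)%N then e * (z i)%:~R else u 0 i))//.
  by apply/rowP => i; rewrite !mxE ltn_ord.
elim: k => [_|k IH kr].
  exists (fun=> 0); split=> [i|]; first by rewrite normr0 addr_ge0// divr_ge0// ltW.
  rewrite big_pred0// [X in _ + X]mulr0 addr0 le_eqVlt; apply/orP; left; apply/eqP.
  by congr (quad B _); apply/rowP => i; rewrite !mxE.
have [z [hz hQ]] := IH (ltnW kr).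
pose i0 := Ordinal kr.
pose f := Num.floor (u 0 i0 / e).
pose t1 := e * f%:~R - u 0 i0.
pose t2 := e * (f + 1)%:~R - u 0 i0.
have fle : f%:~R <= u 0 i0 / e := floor_le _.
have flt : u 0 i0 / e < (f + 1)%:~R := floorD1_gt _.
have ue : u 0 i0 = e * (u 0 i0 / e) by rewrite mulrC divfK// gt_eqF.
have t10 : t1 <= 0 by rewrite /t1 subr_le0 [leRHS]ue ler_wpM2l// ltW.
have t20 : 0 < t2 by rewrite /t2 subr_gt0 [ltLHS]ue ltr_pM2l.
have t21 : t2 - t1 = e by rewrite /t1 /t2 intrD; ring.
set v := \row_i (if (i < k)%N then e * (z i)%:~R else u 0 i) in hQ.
have [t ht hQt] := @quad_round1 _ _ B v i0 t1 t2 (D i0) t10 t20 (D0 _) (BD _).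
have [g [gE gB]] : exists g : int, t = e * g%:~R - u 0 i0 /\
    `|g%:~R| <= `|u 0 i0| / e + 1.
  have ha : `|u 0 i0 / e| = `|u 0 i0| / e by rewrite normrM normfV (gtr0_norm e0).
  rewrite -ha; move: fle flt; rewrite intrD; set a := u 0 i0 / e => fle flt.
  case: ht => ->; [exists f|exists (f + 1)]; split=> //; rewrite ?intrD;
    rewrite ler_norml; have := ler_norm a; have := ler_norm (- a); rewrite normrN;
    by move=> h1 h2; apply/andP; split; lra.
exists (fun i => if i == i0 then g else z i); split.
  by move=> i; case: eqP => // ->.
rewrite (bigD1 i0)//= mulrDr [X in _ + X]addrC addrA.
rewrite (eq_bigl (fun i : 'I_r => (i < k)%N)); last first.
  by move=> i; rewrite ltnS -val_eqE/= andbC -ltn_neqAle.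
rewrite [X in quad B X](_ : _ = v + t *: delta_mx 0 i0).
  by rewrite t21 in hQt; lra.
apply/rowP => i; rewrite !mxE eqxx/= ltnS gE.
have [->|ii0] := eqVneq i i0.
  by rewrite leqnn ltnn mulr1 addrC subrK.
by move: ii0; rewrite mulr0 addr0 leq_eqVlt -val_eqE/= => /negbTE ->.
Qed.

Lemma sum_geo34 (R : realType) (m : nat) :
  \sum_(k < m) (3 / 4 : R) ^+ k = 4 - 4 * (3 / 4) ^+ m.
Proof.
elim: m => [|m IH]; first by rewrite big_ord0 expr0; lra.
by rewrite big_ord_recr/= IH exprS; set a := _ ^+ m; lra.
Qed.

Lemma sum_geo34_rev (R : realType) (m : nat) :
  \sum_(k < m) (3 / 4 : R) ^+ (m - k) = 3 - 3 * (3 / 4) ^+ m.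
Proof.
elim: m => [|m IH]; first by rewrite big_ord0 expr0; lra.
by rewrite big_ord_recl/= subn0 IH exprS; set a := _ ^+ m; lra.
Qed.

(** The type ['I_(m + m.+1)] encodes the integers from [- m] to [m], so that the net is a set over a
    finite type. *)
Definition shifted (m : nat) (j : 'I_(m + m.+1)) : int := j%:Z - m%:Z.

(** Confining coordinates to [[- 3 r, 3 r]] loses no integer point, since the l1 bound implies
    it. *)
Definition l1_net (r : nat) : {set {ffun 'I_r -> 'I_(3 * r + (3 * r).+1)}} :=
  [set z : {ffun 'I_r -> 'I_(3 * r + (3 * r).+1)} | (\sum_(i < r) `|shifted (z i)| <= 3 * r)%N]%SET.

(** Give every [z] in the box the weight [(4 / 3)^(3 r)] times the product of the [(3 / 4)^|z_i|],
    which is at least 1 on the net. The total weight factors over coordinates into geometric sums,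
    each at most 7, and [(4 / 3)^3 * 7 <= 17]. *)
Lemma card_l1_net (R : realType) (r : nat) : (#|l1_net r|%:R <= 17 ^+ r :> R).
Proof.
pose m := (3 * r)%N.
have h7 : \sum_(j < m + m.+1) (3 / 4 : R) ^+ `|shifted j| <= 7.
  rewrite big_split_ord/=.
  under eq_bigr => j _.
    have -> : `|shifted (lshift m.+1 j)|%N = (m - j)%N.
      by rewrite /shifted/= distnC; have := ltn_ord j; lia.
    over.
  under [X in _ + X]eq_bigr => j _.
    have -> : `|shifted (rshift m j)|%N = j by rewrite /shifted/= PoszD addrC addKr.
    over.
  rewrite sum_geo34_rev sum_geo34.
  have : 0 <= (3 / 4 : R) ^+ m by rewrite exprn_ge0.
  have : 0 <= (3 / 4 : R) ^+ m.+1 by rewrite exprn_ge0.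
  lra.
have -> : #|l1_net r|%:R = \sum_(z in l1_net r) 1 :> R by rewrite sumr_const.
apply: (@le_trans _ _ (\sum_(z : {ffun 'I_r -> 'I_(m + m.+1)})
    (4 / 3) ^+ m * \prod_i (3 / 4 : R) ^+ `|shifted (z i)|)).
  rewrite [leRHS](bigID (mem (l1_net r)))/= -[leLHS]addr0; apply: lerD.
    apply: ler_sum => z; rewrite inE => hz.
    rewrite prodrXr.
    have hm : 0 < (3 / 4 : R) ^+ m by rewrite exprn_gt0//; lra.
    rewrite (_ : 4 / 3 = (3 / 4)^-1); last by rewrite invf_div.
    rewrite exprVn mulrC ler_pdivlMr// mul1r.
    by apply: ler_wiXn2l => //; lra.
  by apply: sumr_ge0 => z _; rewrite mulr_ge0 ?exprn_ge0 ?prodr_ge0// => *; rewrite ?exprn_ge0.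
rewrite -big_distrr/= -(bigA_distr_bigA (fun (i : 'I_r) j => (3 / 4) ^+ `|shifted j|)).
rewrite prodr_const card_ord exprM -exprMn.
have h0 : 0 <= \sum_(j < m + m.+1) (3 / 4 : R) ^+ `|shifted j|.
  by apply: sumr_ge0 => j _; rewrite exprn_ge0.
have h17 : (4 / 3) ^+ 3 * \sum_(j < m + m.+1) (3 / 4 : R) ^+ `|shifted j| <= 17.
  have -> : (4 / 3 : R) ^+ 3 = 64 / 27 by field.
  lra.
by rewrite lerXn2r// nnegrE ?mulr_ge0 ?exprn_ge0//; lra.
Qed.

Lemma net_quad (R : realType) (r : nat) (B : 'M[R]_r) (u : 'rV[R]_r)
    (D : 'I_r -> R) : (0 < r)%N -> fro2 u = 1 ->
  (forall i, 0 <= D i) -> (forall i, B i i <= D i) ->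
  exists2 z, z \in l1_net r &
    (4 * r%:R)^-1 * quad B (\row_i (shifted (z i))%:~R) <=
    quad B u + (16 * r%:R)^-1 * \sum_i D i.
Proof.
move=> r0 u1 D0 BD.
pose s := Num.sqrt (r%:R : R).
have s0 : 0 < s by rewrite sqrtr_gt0 ltr0n.
have s2 : s ^+ 2 = r%:R by rewrite sqr_sqrtr// ler0n.
(* With this mesh the loss [e^2 / 4] of [quad_round] is [1 / (16 r)]. *)
pose e := (2 * s)^-1.
have e0 : 0 < e by rewrite invr_gt0 mulr_gt0.
have e2 : e ^+ 2 = (4 * r%:R)^-1 by rewrite exprVn exprMn s2; congr (_ * _)^-1; ring.
have [z [hz hQ]] := quad_round u e0 D0 BD.
have hsum : (\sum_i `|z i| <= 3 * r)%N.
  rewrite -(ler_nat R) natrM natr_sum.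
  have -> : \sum_i `|z i|%N%:R = \sum_i `|(z i)%:~R| :> R.
    by apply: eq_bigr => i _; rewrite natr_absz intr_norm.
  (* From [2 s |u_i| <= r u_i^2 + 1], each [|z_i|] is at most [r u_i^2 + 2]; these bounds sum to
     [3 r] because [u] is a unit vector. *)
  apply: (@le_trans _ _ (\sum_(i < r) (r%:R * u 0 i ^+ 2 + 2))).
    apply: ler_sum => i _; apply: (le_trans (hz i)).
    rewrite /e invrK -s2 -(real_normK (num_real (u 0 i))).
    have := sqr_ge0 (s * `|u 0 i| - 1); nra.
  rewrite big_split/= -mulr_sumr sumr_const card_ord.
  move: u1; rewrite /fro2 big_ord1 => ->.
  by rewrite mulr1 -[2 *+ r]mulr_natr; lra.
have hzi i : (`|z i| <= 3 * r)%N by rewrite (leq_trans _ hsum)// (bigD1 i)//= leq_addr.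
have hlt i : (`|(z i + (3 * r)%:Z)%R| < 3 * r + (3 * r).+1)%N by have := hzi i; lia.
pose z' : {ffun 'I_r -> 'I_(3 * r + (3 * r).+1)} := [ffun i => Ordinal (hlt i)].
have zz' i : shifted (z' i) = z i.
  by rewrite /shifted ffunE/=; have := hzi i; lia.
exists z'; first by rewrite inE; under eq_bigr do rewrite zz'.
move: hQ; rewrite e2.
have -> : \row_i (e * (z i)%:~R) = e *: \row_i (shifted (z' i))%:~R.
  by apply/rowP => i; rewrite !mxE zz'.
have -> (x : 'rV[R]_r) : quad B (e *: x) = e ^+ 2 * quad B x.
  rewrite /quad linearZ/= -scalemxAl -scalemxAl -scalemxAr [LHS]mxE [X in _ * X]mxE.
  by rewrite mulrA expr2.
rewrite e2 => /le_trans; apply; rewrite lerD2l ler_wpM2r ?sumr_ge0//.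
by rewrite -invfM; rewrite le_eqVlt; apply/orP; left; apply/eqP; congr _^-1; ring.
Qed.

(** * Norms, pseudo-inverses and singular values *)

Lemma fro2_tr (R : realType) (p q : nat) (A : 'M[R]_(p, q)) : fro2 A^T = fro2 A.
Proof.
by rewrite /fro2 exchange_big/=; apply: eq_bigr => i _; apply: eq_bigr => j _; rewrite mxE.
Qed.

Lemma fro2_col (R : realType) (p : nat) (x : 'cV[R]_p) : (x^T *m x) 0 0 = fro2 x.
Proof. by rewrite -fro2_tr -fro2_row trmxK. Qed.

Lemma fro2_sum_col (R : realType) (p q : nat) (A : 'M[R]_(p, q)) :
  fro2 A = \sum_j fro2 (col j A).
Proof.
rewrite /fro2 exchange_big/=; apply: eq_bigr => j _; apply: eq_bigr => i _.
by rewrite big_ord1 mxE.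
Qed.

Lemma fro2_scale (R : realType) (p q : nat) (a : R) (A : 'M[R]_(p, q)) :
  fro2 (a *: A) = a ^+ 2 * fro2 A.
Proof.
rewrite /fro2 mulr_sumr; apply: eq_bigr => i _.
by rewrite mulr_sumr; apply: eq_bigr => j _; rewrite mxE exprMn.
Qed.

Lemma fro2_0 (R : realType) (p q : nat) : fro2 (0 : 'M[R]_(p, q)) = 0.
Proof. by apply/eqP; rewrite fro2_eq0. Qed.

Lemma fro2_dot_sub (R : realType) (p : nat) (a : R) (x y : 'cV[R]_p) :
  fro2 (x - a *: y) = fro2 x - 2 * a * (x^T *m y) 0 0 + a ^+ 2 * fro2 y.
Proof.
rewrite mxE /fro2 !mulr_sumr -sumrN -!big_split/=; apply: eq_bigr => i _.
by rewrite !big_ord1 !mxE; ring.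
Qed.

Lemma cauchy_schwarz (R : realType) (p : nat) (x y : 'cV[R]_p) :
  (x^T *m y) 0 0 ^+ 2 <= fro2 x * fro2 y.
Proof.
have [y0|] := eqVneq (fro2 y) 0.
  have := y0; move/eqP; rewrite fro2_eq0 => /eqP ->.
  by rewrite mulmx0 mxE expr0n/= fro2_0 mulr0.
move=> y0; have yp : 0 < fro2 y by rewrite lt_neqAle eq_sym y0 fro2_ge0.
set c := (x^T *m y) 0 0.
have := fro2_ge0 (x - (c / fro2 y) *: y); rewrite fro2_dot_sub -/c => h.
have -> : fro2 x * fro2 y = (fro2 x - 2 * (c / fro2 y) * c +
    (c / fro2 y) ^+ 2 * fro2 y) * fro2 y + c ^+ 2 by field.
by rewrite lerDr mulr_ge0// ltW.
Qed.

(** For [0 <= c] this says that [c] bounds the squared spectral norm; the pointwise form composes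
    without handling suprema. *)
Definition opbnd (R : realType) (p q : nat) (A : 'M[R]_(p, q)) (c : R) :=
  forall x : 'cV[R]_q, fro2 (A *m x) <= c * fro2 x.

(** With [z = A^T y], Cauchy-Schwarz gives [|z|^4 = (y, A z)^2 <= |y|^2 c |z|^2]; it remains to
    divide by [|z|^2]. *)
Lemma opbnd_tr (R : realType) (p q : nat) (A : 'M[R]_(p, q)) (c : R) :
  0 <= c -> opbnd A c -> opbnd A^T c.
Proof.
move=> c0 hA y; set z := A^T *m y.
have [z0|z0] := eqVneq (fro2 z) 0; first by rewrite z0 mulr_ge0 ?fro2_ge0.
have zp : 0 < fro2 z by rewrite lt_neqAle eq_sym z0 fro2_ge0.
have e : (y^T *m (A *m z)) 0 0 = fro2 z.
  by rewrite mulmxA -fro2_col /z [in RHS]trmx_mul trmxK.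
have := cauchy_schwarz y (A *m z); rewrite e => h.
have h2 := hA z; have y0 := fro2_ge0 y.
rewrite -(ler_pM2r zp) -expr2 (le_trans h)//.
by rewrite mulrAC mulrC ler_wpM2r.
Qed.

Lemma opbnd_mul (R : realType) (p q s : nat) (A : 'M[R]_(p, q)) (B : 'M[R]_(q, s)) (a b : R) :
  0 <= a -> opbnd A a -> opbnd B b -> opbnd (A *m B) (a * b).
Proof.
move=> a0 hA hB x; rewrite -mulmxA (le_trans (hA _))// -mulrA.
by rewrite ler_wpM2l// hB.
Qed.

Lemma opbnd_orthonormal (R : realType) (p q : nat) (A : 'M[R]_(p, q)) :
  orthonormal_cols A -> opbnd A 1.
Proof.
by move=> hA x; rewrite mul1r -!fro2_col trmx_mul -mulmxA (mulmxA _ A) hA mul1mx.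
Qed.

Lemma fro2_mull (R : realType) (p q s : nat) (A : 'M[R]_(p, q)) (B : 'M[R]_(q, s)) (c : R) :
  opbnd A c -> fro2 (A *m B) <= c * fro2 B.
Proof.
move=> hA; rewrite fro2_sum_col [in leRHS]fro2_sum_col mulr_sumr.
by apply: ler_sum => j _; rewrite !colE -mulmxA; exact: hA.
Qed.

Lemma fro2_mulr (R : realType) (p q s : nat) (A : 'M[R]_(p, q)) (B : 'M[R]_(q, s)) (c : R) :
  0 <= c -> opbnd B c -> fro2 (A *m B) <= c * fro2 A.
Proof.
move=> c0 hB; rewrite -fro2_tr trmx_mul -[in leRHS]fro2_tr; apply: fro2_mull.
exact: opbnd_tr.
Qed.

Lemma opbnd_fro2 (R : realType) (p q : nat) (A : 'M[R]_(p, q)) : opbnd A (fro2 A).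
Proof.
move=> x; rewrite [in leLHS]/fro2 [in leRHS]/fro2 mulr_suml; apply: ler_sum => i _.
rewrite big_ord1.
have -> : (A *m x) i 0 = (((row i A)^T)^T *m x) 0 0.
  by rewrite trmxK !mxE; apply: eq_bigr => j _; rewrite !mxE.
apply: (le_trans (cauchy_schwarz _ _)); rewrite fro2_tr ler_wpM2r ?fro2_ge0//.
by rewrite /fro2 big_ord1; apply: ler_sum => j _; rewrite mxE.
Qed.

Section spectral.
Variables (R : realType) (p q : nat) (A : 'M[R]_(p, q)).
Let S := [set frobenius_norm (A *m x) | x in [set x : 'cV[R]_q | frobenius_norm x <= 1]].

Let unit_fro2 (x : 'cV[R]_q) : frobenius_norm x <= 1 -> fro2 x <= 1.
Proof. by rewrite /frobenius_norm -/(fro2 x) -{1}sqrtr1 ler_sqrt. Qed.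

Let S_ub c : 0 <= c -> opbnd A c -> ubound S (Num.sqrt c).
Proof.
move=> c0 hA _ [x /= /unit_fro2 hx <-]; rewrite /frobenius_norm ler_sqrt//.
by rewrite (le_trans (hA x))// -[leRHS]mulr1 ler_wpM2l.
Qed.

Let S0 : S 0.
Proof.
exists 0; last by rewrite mulmx0 /frobenius_norm -/(fro2 _) fro2_0 sqrtr0.
by rewrite /= /frobenius_norm -/(fro2 _) fro2_0 sqrtr0.
Qed.

Let has_supS : has_sup S.
Proof.
split; first by exists 0.
by exists (Num.sqrt (fro2 A)); apply: S_ub; [exact: fro2_ge0|exact: opbnd_fro2].
Qed.

Lemma spectral_norm_le c : 0 <= c -> opbnd A c -> spectral_norm A <= Num.sqrt c.
Proof. by move=> c0 hA; apply: ge_sup; [exists 0|exact: S_ub]. Qed.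

Lemma spectral_norm_ge0 : 0 <= spectral_norm A.
Proof. by apply: ub_le_sup; [exact: has_supS.2|]. Qed.

Lemma opbnd_spectral_norm : opbnd A (spectral_norm A ^+ 2).
Proof.
move=> x; have [x0|x0] := eqVneq (fro2 x) 0.
  move/eqP: x0; rewrite fro2_eq0 => /eqP ->; by rewrite mulmx0 fro2_0 mulr0 fro2_0.
have xp : 0 < fro2 x by rewrite lt_neqAle eq_sym x0 fro2_ge0.
have sp : 0 < Num.sqrt (fro2 x) by rewrite sqrtr_gt0.
pose y := (Num.sqrt (fro2 x))^-1 *: x.
have hy : Num.sqrt (fro2 (A *m y)) <= spectral_norm A.
  apply: ub_le_sup; first exact: has_supS.2.
  exists y => //=; rewrite /frobenius_norm -/(fro2 y) fro2_scale exprVn.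
  by rewrite sqr_sqrtr ?(ltW xp)// mulVf// sqrtr1.
have : fro2 (A *m y) <= spectral_norm A ^+ 2.
  rewrite -[leLHS]sqr_sqrtr ?fro2_ge0//.
  by rewrite lerXn2r// nnegrE ?sqrtr_ge0// spectral_norm_ge0.
rewrite -scalemxAr fro2_scale exprVn sqr_sqrtr ?(ltW xp)// mulrC.
by rewrite ler_pdivrMr.
Qed.

End spectral.

(** This and [mxnorm_mulr] are the facts about the norm on which the error bound rests, so both
    norms are treated at once. *)
Lemma mxnorm_mull (R : realType) (k : norm_kind) (p q s : nat)
    (A : 'M[R]_(p, q)) (B : 'M[R]_(q, s)) (c : R) :
  0 <= c -> opbnd A c -> mxnorm k (A *m B) <= Num.sqrt c * mxnorm k B.
Proof.
move=> c0 hA; case: k => /=.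
  rewrite -[spectral_norm B]ger0_norm ?spectral_norm_ge0// -sqrtr_sqr -sqrtrM//.
  apply: spectral_norm_le; first by rewrite mulr_ge0// sqr_ge0.
  by apply: opbnd_mul => //; exact: opbnd_spectral_norm.
rewrite /frobenius_norm -!/(fro2 _) -sqrtrM// ler_sqrt ?mulr_ge0 ?fro2_ge0//.
exact: fro2_mull.
Qed.

Lemma mxnorm_mulr (R : realType) (k : norm_kind) (p q s : nat)
    (A : 'M[R]_(p, q)) (B : 'M[R]_(q, s)) (c : R) :
  0 <= c -> opbnd B c -> mxnorm k (A *m B) <= Num.sqrt c * mxnorm k A.
Proof.
move=> c0 hB; case: k => /=.
  rewrite mulrC -[spectral_norm A]ger0_norm ?spectral_norm_ge0//.
  rewrite -sqrtr_sqr -sqrtrM ?sqr_ge0//.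
  apply: spectral_norm_le; first by rewrite mulr_ge0// sqr_ge0.
  by apply: opbnd_mul; [exact: sqr_ge0|exact: opbnd_spectral_norm|].
rewrite /frobenius_norm -!/(fro2 _) -sqrtrM// ler_sqrt ?mulr_ge0 ?fro2_ge0//.
exact: fro2_mulr.
Qed.

Lemma gram_unitmx (R : realType) (p q : nat) (C : 'M[R]_(p, q)) :
  row_free C -> C *m C^T \in unitmx.
Proof.
move=> fC; rewrite -row_free_unit -kermx_eq0; apply/eqP/row_matrixP => i.
rewrite row0; apply/eqP; set v := row i _.
have : v *m (C *m C^T) = 0 by apply: sub_kermxP; exact: row_sub.
move=> /(congr1 (fun M => (M *m v^T) 0 0)); rewrite mul0mx [RHS]mxE => h.
have : fro2 (v *m C) = 0 by rewrite -fro2_row trmx_mul !mulmxA in h *.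
by move/eqP; rewrite fro2_eq0 mulmx_free_eq0.
Qed.

(** A full-rank factorization [A = C D] gives the explicit solution
    [D^T (D D^T)^-1 (C^T C)^-1 C^T]. *)
Lemma ex_pinv (R : realType) (p q : nat) (A : 'M[R]_(p, q)) : exists B, is_pinv A B.
Proof.
have [k [C [D [AE fC fD]]]] : exists k (C : 'M[R]_(p, k)) (D : 'M[R]_(k, q)),
    [/\ A = C *m D, row_free C^T & row_free D].
  exists (\rank A), (col_base A), (row_base A); split.
  - by rewrite mulmx_base.
  - by rewrite /row_free mxrank_tr; exact: col_base_full.
  - exact: row_base_free.
have uD : D *m D^T \in unitmx by exact: gram_unitmx.
have uC : C^T *m C \in unitmx by rewrite -{2}[C]trmxK; exact: gram_unitmx.
exists (D^T *m invmx (D *m D^T) *m (invmx (C^T *m C) *m C^T)).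
set E := D^T *m invmx (D *m D^T); set F := invmx (C^T *m C) *m C^T.
have DE : D *m E = 1%:M by rewrite mulmxA mulmxV.
have FC : F *m C = 1%:M by rewrite -mulmxA mulVmx.
have AB : A *m (E *m F) = C *m F by rewrite AE -mulmxA (mulmxA D) DE mul1mx.
have BA : E *m F *m A = E *m D by rewrite AE -mulmxA (mulmxA F) FC mul1mx.
split.
- by rewrite AB {1}AE -mulmxA (mulmxA F) FC mul1mx -AE.
- by rewrite BA -mulmxA (mulmxA D) DE mul1mx.
- by rewrite AB /F !trmx_mul trmxK trmx_inv trmx_mul trmxK mulmxA.
- by rewrite BA /E !trmx_mul trmxK trmx_inv trmx_mul trmxK mulmxA.
Qed.

Lemma pinv_is_pinv (R : realType) (p q : nat) (A : 'M[R]_(p, q)) : is_pinv A (Defs.pinv A).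
Proof. exact: (@xgetPex _ 0 [set B | is_pinv A B] (ex_pinv A)). Qed.

(** By the Penrose equations [X X^+] is symmetric and idempotent, so its complement is an orthogonal
    projector. *)
Lemma projector_compl (R : realType) (p q : nat) (X : 'M[R]_(p, q)) :
  opbnd (1%:M - X *m Defs.pinv X) 1.
Proof.
have [h1 _ h3 _] := pinv_is_pinv X; set Pj := X *m Defs.pinv X in h1 h3 *.
have PP : Pj *m Pj = Pj by rewrite {2}/Pj mulmxA h1.
move=> x; rewrite mul1r -!fro2_col trmx_mul -mulmxA (mulmxA _ (1%:M - Pj)).
have -> : (1%:M - Pj)^T *m (1%:M - Pj) = 1%:M - Pj.
  by rewrite [(1%:M - Pj)^T]linearB/= trmx1 h3 mulmxBl mul1mx mulmxBr mulmx1 PP subrr subr0.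
rewrite mulmxBl mul1mx mulmxBr [leLHS]mxE gerDl [leLHS]mxE oppr_le0.
by rewrite -PP -{1}h3 -mulmxA mulmxA -trmx_mul fro2_col fro2_ge0.
Qed.

(** The error analysis uses the algorithm only through these properties of [C]. The matrix [T]
    disappears because [M H = X T] lies in the range of [X]. *)
Lemma sketch_residual (R : realType) (m n l : nat) (M : 'M[R]_(m, n))
    (H : 'M[R]_(n, l)) (T : 'M[R]_l) : T \in unitmx ->
  exists C : 'M[R]_m, [/\ opbnd C 1, C *m (M *m H) = 0 &
    M - sketch_X M H T *m sketch_Y M H T = C *m M].
Proof.
move=> uT; set X := sketch_X M H T.
exists (1%:M - X *m Defs.pinv X); split; first exact: projector_compl.
- have -> : M *m H = X *m T by rewrite /X /sketch_X mulmxKV.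
  rewrite mulmxA mulmxBl mul1mx.
  by have [-> _ _ _] := pinv_is_pinv X; rewrite subrr mul0mx.
- by rewrite mulmxBl mul1mx /sketch_Y -/X mulmxA.
Qed.

(** Full column rank gives [H^+ H = 1], so the product of the two norms bounds the identity; the
    all-ones vector, nonzero as [0 < l], serves as test vector. *)
Lemma cond_number_ge1 (R : realType) (n l : nat) (H : 'M[R]_(n, l)) :
  (0 < l)%N -> \rank H = l -> 1 <= cond_number H.
Proof.
move=> l0 rH; have [h1 _ _ _] := pinv_is_pinv H.
have fH : row_free H^T by rewrite /row_free mxrank_tr rH.
have inv : Defs.pinv H *m H = 1%:M.
  apply/trmx_inj; apply: (row_free_inj fH).
  by rewrite trmx1 mul1mx -[in RHS]h1 -mulmxA [in RHS]trmx_mul.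
have : opbnd (1%:M : 'M[R]_l) (spectral_norm (Defs.pinv H) ^+ 2 * spectral_norm H ^+ 2).
  rewrite -inv; apply: opbnd_mul; first exact: sqr_ge0.
    exact: opbnd_spectral_norm.
  exact: opbnd_spectral_norm.
move=> /(_ (const_mx 1)); rewrite mul1mx.
have cp : 0 < fro2 (const_mx 1 : 'cV[R]_l).
  rewrite /fro2 (eq_bigr (fun=> 1)) => [|i _]; last by rewrite big_ord1 mxE expr1n.
  by rewrite sumr_const card_ord ltr0n.
rewrite -[leLHS]mul1r ler_pM2r// -exprMn mulrC => h.
by rewrite -(@ler_pXn2r _ 2)// ?nnegrE ?mulr_ge0 ?spectral_norm_ge0// expr1n.
Qed.

(** [L] is the inverse of a Cholesky factor, built by recursion on the Schur complement. *)
Lemma posdef_sqrt (R : realType) (l : nat) (S : 'M[R]_l) : posdef S ->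
  exists L : 'M[R]_l, L^T *m S *m L = 1%:M.
Proof.
elim: l => [|l IH] in S *; first by exists 1%:M; rewrite [LHS]flatmx0 [RHS]flatmx0.
move=> SP; have [L hL] := IH _ (schur_posdef SP).
set p := S 0 0; have p0 : 0 < p := schur_pivot_gt0 SP.
set q : 'rV[R]_l := ursubmx (S : 'M[R]_(1 + l)).
pose s := (Num.sqrt p)^-1.
have s2 : s * p * s = 1.
  by rewrite mulrAC -expr2 exprVn sqr_sqrtr ?(ltW p0)// mulVf// gt_eqF.
(* The upper right block is chosen to make the off-diagonal blocks of the congruence vanish. *)
pose L1 : 'M[R]_(1 + l) := block_mx s%:M (- (p^-1 *: q) *m L) 0 L.
suff H : L1^T *m (block_mx p%:M q q^T (drsubmx (S : 'M[R]_(1 + l)))) *m L1 = 1%:M.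
  by exists L1; rewrite -[RHS]H; congr (_ *m _ *m _); exact: schur_block.
rewrite /L1 tr_block_mx !mulmx_block.
rewrite tr_scalar_mx trmx0 !mul0mx !mulmx0 !addr0.
have z1 : p%:M *m (- (p^-1 *: q) *m L) + q *m L = 0.
  rewrite mul_scalar_mx scalemxAl scalerN scalerA mulfV ?gt_eqF// scale1r.
  by rewrite mulNmx addNr.
have z2 : (- (p^-1 *: q) *m L)^T *m p%:M + L^T *m q^T = 0.
  by have := congr1 trmx z1; rewrite linear0 linearD/= !trmx_mul tr_scalar_mx.
rewrite [RHS](_ : _ = block_mx 1%:M 0 0 1%:M); last by rewrite -scalar_mx_block.
congr block_mx.
- by rewrite -!scalar_mxM s2.
- by rewrite -!mulmxA -mulmxDr z1 mulmx0.
- by rewrite z2 mul0mx.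
- rewrite z2 mul0mx add0r -hL /schur_compl -/p -/q; congr (_ *m _).
  rewrite mulmxBr addrC trmx_mul linearN/= linearZ/= -mulmxA mulNmx mulmxN.
  by rewrite -scalemxAl.
Qed.

(** Gram-Schmidt in matrix form: [S] reduces the Gram matrix [H^T H] to the identity. *)
Lemma orthonormalize (R : realType) (n l : nat) (H : 'M[R]_(n, l)) :
  \rank H = l -> exists S : 'M[R]_l, orthonormal_cols (H *m S).
Proof.
move=> rH; have fH : row_free H^T by rewrite /row_free mxrank_tr rH.
have SP : posdef (H^T *m H).
  split; first by rewrite trmx_mul trmxK.
  move=> x x0; have -> : (x *m (H^T *m H) *m x^T) 0 0 = fro2 (x *m H^T).
    by rewrite -fro2_row trmx_mul trmxK !mulmxA.
  by rewrite lt_neqAle fro2_ge0 eq_sym fro2_eq0 mulmx_free_eq0// x0.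
have [L hL] := posdef_sqrt SP.
by exists L; rewrite /orthonormal_cols trmx_mul -hL !mulmxA.
Qed.

Lemma char_poly_conj (R : comNzRingType) (n : nat) (V D : 'M[R]_n) (W : 'M[R]_n) :
  W *m V = 1%:M -> char_poly (V *m D *m W) = char_poly D.
Proof.
move=> WV; have VW := mulmx1C WV.
rewrite /char_poly /char_poly_mx.
have -> : 'X%:M - map_mx polyC (V *m D *m W) =
    map_mx polyC V *m ('X%:M - map_mx polyC D) *m map_mx polyC W.
  rewrite !map_mxM mulmxBr mulmxBl; congr (_ - _).
  by rewrite mul_mx_scalar -scalemxAl -map_mxM VW map_mx1 scalemx1.
rewrite !det_mulmx mulrAC -det_mulmx -map_mxM VW map_mx1 det1.
by rewrite mul1r.
Qed.

Lemma rdiag_gram (R : realType) (m n : nat) (s : nat -> R) : (n <= m)%N ->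
  (rdiag_mx m n s)^T *m rdiag_mx m n s = diag_mx (\row_(j < n) s j.+1 ^+ 2).
Proof.
move=> nm; apply/matrixP => i j; rewrite !mxE.
rewrite (bigD1 (widen_ord nm i))//= big1 ?addr0 => [|k ki].
  rewrite !mxE/= eqxx.
  have [->|ij] := eqVneq i j; first by rewrite eqxx mulr1n expr2.
  by rewrite -val_eqE/= in ij; rewrite (negbTE ij) mulr0 mulr0n.
rewrite !mxE; case: eqP => [e|]; last by rewrite mul0r.
by move/eqP: ki; case; apply/val_inj.
Qed.

(** The squares of the singular values are the roots, with multiplicity, of the characteristic
    polynomial of [A^T A]. Sorted lists with the same roots coincide, and nonnegativity removes the
    squares. *)
Lemma singular_values_unique (R : realType) (m n : nat) (A : 'M[R]_(m, n))
    (U U' : 'M[R]_m) (s s' : nat -> R) (V V' : 'M[R]_n) : (n <= m)%N ->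
  is_svd A U s V -> is_svd A U' s' V' ->
  forall j, (0 < j <= n)%N -> s j = s' j.
Proof.
move=> nm svd svd'.
have cp U0 (s0 : nat -> R) V0 : is_svd A U0 s0 V0 ->
    char_poly (A^T *m A) = \prod_(x <- [seq s0 i.+1 ^+ 2 | i <- iota 0 n]) ('X - x%:P).
  move=> [hU hV _ ->].
  have -> : (U0 *m rdiag_mx m n s0 *m V0^T)^T *m (U0 *m rdiag_mx m n s0 *m V0^T) =
      V0 *m diag_mx (\row_(j < n) s0 j.+1 ^+ 2) *m V0^T.
    rewrite !trmx_mul trmxK -(rdiag_gram s0 nm) !mulmxA; congr (_ *m _ *m _).
    by rewrite -[LHS]mulmxA hU mulmx1.
  rewrite char_poly_conj// char_poly_trig ?diag_mx_is_trig//.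
  have -> : iota 0 n = index_iota 0 n by rewrite /index_iota subn0.
  rewrite big_map big_mkord.
  by apply: eq_bigr => i _; rewrite !mxE eqxx mulr1n.
have sq_sorted (s0 : nat -> R) : noninc_nonneg (minn m n) s0 ->
    sorted >=%R [seq s0 i.+1 ^+ 2 | i <- iota 0 n].
  rewrite (minn_idPr nm) => -[h1 h2].
  apply: (@homo_sorted_in _ _ (fun i => i < n)%N _ leq).
  - move=> i j /= hi hj ij; rewrite lerXn2r// ?nnegrE ?h2// h1//.
  - by apply/allP => i; rewrite mem_iota.
  - exact: iota_sorted.
have [_ _ hs _] := svd; have [_ _ hs' _] := svd'.
have pe : perm_eq [seq s i.+1 ^+ 2 | i <- iota 0 n] [seq s' i.+1 ^+ 2 | i <- iota 0 n].
  by apply: prod_XsubC_eq; rewrite -(cp _ _ _ svd) -(cp _ _ _ svd').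
have se := sorted_eq ge_trans ge_anti (sq_sorted _ hs) (sq_sorted _ hs') pe.
case=> // j /= jn.
have := congr1 (fun q => nth 0 q j) se.
rewrite !(nth_map 0%N) ?size_iota// nth_iota// => e.
move: hs hs'; rewrite (minn_idPr nm) => -[_ h2] [_ h2'].
by apply/eqP; rewrite -(eqrXn2 (n := 2))// ?h2 ?h2'//; apply/eqP.
Qed.

(** * The deterministic error bound *)

(** Multiplying by it on the left extracts the rows [f i]; for injective [f] this is a
    contraction. *)
Definition inj_mx (R : realType) (p q : nat) (f : 'I_p -> 'I_q) : 'M[R]_(p, q) :=
  \matrix_(i, j) (f i == j)%:R.

Lemma opbnd_inj_mx (R : realType) (p q : nat) (f : 'I_p -> 'I_q) :
  injective f -> opbnd (inj_mx R f) 1.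
Proof.
move=> finj; rewrite -[inj_mx R f]trmxK; apply: opbnd_tr => //.
apply: opbnd_orthonormal; rewrite /orthonormal_cols trmxK.
apply/matrixP => i j; rewrite !mxE (bigD1 (f i))//= big1 => [|k ki].
  by rewrite !mxE eqxx mul1r addr0 (inj_eq finj) eq_sym.
by rewrite !mxE eq_sym (negbTE ki) mul0r.
Qed.

Lemma inj_mx_mul (R : realType) (p q p' q' : nat) (f : 'I_p -> 'I_p') (g : 'I_q -> 'I_q')
    (A : 'M[R]_(p', q')) i j :
  (inj_mx R f *m A *m (inj_mx R g)^T) i j = A (f i) (g j).
Proof.
rewrite mxE (bigD1 (g j))//= big1 => [|k kj].
  rewrite !mxE eqxx mulr1 addr0 (bigD1 (f i))//= big1 => [|k ki].
    by rewrite !mxE eqxx mul1r addr0.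
  by rewrite !mxE eq_sym (negbTE ki) mul0r.
by rewrite !mxE eq_sym (negbTE kj) mulr0.
Qed.

(** The SVD behind [rank_trunc] may differ from the given one, but its singular values agree. Hence
    [Sigma_perp] is a block of [U'^T (M - M_r) V'], and is cut out of [M - M_r] by contractions. *)
Lemma Sigma_perp_le_tail (R : realType) (k : norm_kind) (m n r : nat) (sigma : nat -> R)
    (M : 'M[R]_(m, n)) (U : 'M[R]_m) (V : 'M[R]_n) :
  (n <= m)%N -> (r <= n)%N -> is_svd M U sigma V ->
  mxnorm k (Sigma_perp m n r sigma) <= tail_sigma k r M.
Proof.
move=> nm rn svd; rewrite /tail_sigma.
have [U' [s [V' [svd' BE]]]] : exists U' s V', is_svd M U' s V' /\ rank_trunc r M =
    U' *m rdiag_mx m n (fun j => if (j <= r)%N then s j else 0) *m V'^T.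
  apply: (@xgetPex _ 0 [set B | exists U s V, is_svd M U s V /\ B = U *m rdiag_mx m n
    (fun j => if (j <= r)%N then s j else 0) *m V^T]).
  by exists (U *m rdiag_mx m n (fun j => if (j <= r)%N then sigma j else 0) *m V^T), U, sigma, V.
have ss := singular_values_unique nm svd svd'.
have [hU hV _ ME] := svd'.
have fm (i : 'I_(m - r)) : (r + i < m)%N by have := ltn_ord i; lia.
have gm (i : 'I_(n - r)) : (r + i < n)%N by have := ltn_ord i; lia.
pose f i := Ordinal (fm i); pose g j := Ordinal (gm j).
have finj : injective f by move=> i j [] /addnI /val_inj.
have ginj : injective g by move=> i j [] /addnI /val_inj.
have -> : Sigma_perp m n r sigma = inj_mx R f *m U'^T *m (M - rank_trunc r M) *m
    (V' *m (inj_mx R g)^T).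
  have -> : inj_mx R f *m U'^T *m (M - rank_trunc r M) *m (V' *m (inj_mx R g)^T) =
      inj_mx R f *m (U'^T *m (M - rank_trunc r M) *m V') *m (inj_mx R g)^T.
    by rewrite !mulmxA.
  rewrite [U'^T *m _ *m V'](_ : _ = rdiag_mx m n s -
      rdiag_mx m n (fun j => if (j <= r)%N then s j else 0)); last first.
    by rewrite BE ME -mulmxBl -mulmxBr !mulmxA hU mul1mx -mulmxA hV mulmx1.
  apply/matrixP => i j; rewrite inj_mx_mul !mxE/= eqn_add2l.
  case: eqP => [ij|_]; last by rewrite subr0.
  rewrite ifN; last by rewrite -ltnNge ltnS leq_addr.
  by rewrite subr0 -ss ?addnS//= ij; exact: gm.
have V1 : opbnd (V' *m (inj_mx R g)^T) 1.
  rewrite -[X in opbnd _ X]mulr1; apply: opbnd_mul => //; first exact: opbnd_orthonormal.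
  by apply: opbnd_tr => //; exact: opbnd_inj_mx.
have U1 : opbnd (inj_mx R f *m U'^T) 1.
  rewrite -[X in opbnd _ X]mulr1; apply: opbnd_mul => //; first exact: opbnd_inj_mx.
  by apply: opbnd_tr => //; exact: opbnd_orthonormal.
apply: (le_trans (mxnorm_mulr k _ ler01 V1)); rewrite sqrtr1 mul1r.
by apply: (le_trans (mxnorm_mull k _ ler01 U1)); rewrite sqrtr1 mul1r.
Qed.

Lemma mulmx_castr (R : realType) (s p m q : nat) (e : p = m) (U : 'M[R]_(s, m))
    (A : 'M[R]_(p, q)) : U *m castmx (e, erefl q) A = castmx (erefl s, esym e) U *m A.
Proof. by case: m / e U => U; rewrite !castmx_id. Qed.

Lemma orthonormal_castr (R : realType) (s p m : nat) (e : m = p) (U : 'M[R]_(s, m)) :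
  orthonormal_cols U -> orthonormal_cols (castmx (erefl s, e) U).
Proof. by case: p / e. Qed.

Lemma orthonormal_row_mx (R : realType) (n r k j : nat) (G : 'M[R]_(r, n))
    (Q : 'M[R]_(n, k)) (Qperp : 'M[R]_(n, j)) :
  row_space_onb G Q -> row_space_perp_onb G Qperp -> orthonormal_cols (row_mx Q Qperp).
Proof.
move=> [hQ /andP[/submxP[C QE] _]] [hP /andP[PE _]].
have PG : Qperp^T *m G^T = 0 by exact: sub_kermxP.
have PQ : Qperp^T *m Q = 0 by rewrite -[Q]trmxK QE trmx_mul mulmxA PG mul0mx.
have QP : Q^T *m Qperp = 0 by rewrite -[LHS]trmxK trmx_mul trmxK PQ trmx0.
by rewrite /orthonormal_cols tr_row_mx mul_col_row hQ hP PQ QP -scalar_mx_block.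
Qed.

(** Up to casts of dimensions the block diagonal factor is [rdiag_mx m n sigma], so the definition
    of the matrix is itself an SVD with right factor [row_mx Q Qperp]. *)
Lemma factor_mx_svd (R : realType) (m n r : nat) (hrm : (r <= m)%N) (sigma : nat -> R)
    (U : 'M[R]_m) (Q : 'M[R]_(n, r)) (Qperp : 'M[R]_(n, n - r)) :
  (n <= m)%N -> (r <= n)%N -> noninc_nonneg n sigma -> orthonormal_cols U ->
  orthonormal_cols (row_mx Q Qperp) ->
  exists V, is_svd (factor_mx hrm sigma U Q Qperp) U sigma V.
Proof.
move=> nm rn hs hU hW; pose e := subnKC rn.
have We : castmx (e, erefl n) (row_mx Q Qperp)^T = (castmx (erefl n, e) (row_mx Q Qperp))^T.
  by rewrite trmx_cast.
have hV : orthonormal_cols (castmx (erefl n, e) (row_mx Q Qperp)).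
  exact: orthonormal_castr.
exists (castmx (erefl n, e) (row_mx Q Qperp)); split=> //.
  by rewrite (minn_idPr nm).
rewrite /factor_mx -tr_row_mx -We -[RHS]mulmxA [in RHS]mulmx_castr mulmxA; congr (_ *m _ *m _).
apply/matrixP => i j; rewrite !castmxE/= !mxE /=.
set i' := cast_ord _ i; have ii : i = i' :> nat by [].
rewrite cast_ord_id ii.
case: (split_ordP i') => a ->; rewrite !mxE; case: (split_ordP j) => b ->; rewrite !mxE/=.
- by rewrite -val_eqE/=; case: eqP => [->|]; rewrite ?mulr1n ?mulr0n.
- by rewrite ifN// neq_ltn; have := ltn_ord a; lia.
- by rewrite ifN// neq_ltn; have := ltn_ord b; lia.
- by rewrite eqn_add2l addnS.
Qed.

(** Young's inequality, entry by entry. *)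
Lemma fro2_sub_le (R : realType) (p q : nat) (A B : 'M[R]_(p, q)) (k : R) : 0 < k ->
  fro2 (A - B) <= (1 + k) * fro2 A + (1 + k^-1) * fro2 B.
Proof.
move=> k0; rewrite /fro2 !mulr_sumr -big_split/=; apply: ler_sum => i _.
rewrite !mulr_sumr -big_split/=; apply: ler_sum => j _; rewrite !mxE -subr_ge0.
set a := A i j; set b := B i j.
have -> : (1 + k) * a ^+ 2 + (1 + k^-1) * b ^+ 2 - (a - b) ^+ 2 =
  k^-1 * (k * a + b) ^+ 2 by field; rewrite gt_eqF.
by rewrite mulr_ge0 ?sqr_ge0// invr_ge0 ltW.
Qed.

(** [C] annihilates [M *m (H *m S) *m F *m Q^T], which may therefore be subtracted from [M]. As [F]
    is a right inverse of [Q^T *m (H *m S)], this cancels the [Sigma_r] block and leaves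
    [Sigma_perp] times [Qperp^T - K *m Q^T]. *)
Lemma residual_bound (R : realType) (k : norm_kind) (m n r l : nat) (hrm : (r <= m)%N)
    (sigma : nat -> R) (U : 'M[R]_m) (Q : 'M[R]_(n, r)) (Qperp : 'M[R]_(n, n - r))
    (H : 'M[R]_(n, l)) (S T : 'M[R]_l) (F : 'M[R]_(l, r)) (kappa : R) :
  orthonormal_cols U -> orthonormal_cols (row_mx Q Qperp) -> T \in unitmx ->
  orthonormal_cols (H *m S) -> Q^T *m (H *m S) *m F = 1%:M -> 0 < kappa -> opbnd F kappa ->
  let M := factor_mx hrm sigma U Q Qperp in
  mxnorm k (M - sketch_X M H T *m sketch_Y M H T) <=
    Num.sqrt (1 + kappa) * mxnorm k (Sigma_perp m n r sigma).
Proof.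
move=> hU hW uT hH QHF k0 hF; cbv zeta.
move ME : (factor_mx _ _ _ _ _) => M.
have [C [hC CMH ->]] := sketch_residual M H uT.
have CMHF : C *m (M *m (H *m S) *m F *m Q^T) = 0.
  by rewrite !mulmxA -(mulmxA C) CMH !mul0mx.
rewrite -[C *m M]subr0 -CMHF -mulmxBr.
set K := Qperp^T *m (H *m S) *m F.
pose e := subnKC hrm; pose U' := castmx (erefl m, esym e) U.
have hU' : orthonormal_cols U' by exact: orthonormal_castr.
have {}ME : M = U' *m col_mx (Sigma_r r sigma *m Q^T) (Sigma_perp m n r sigma *m Qperp^T).
  by rewrite -ME /factor_mx mulmx_castr -mulmxA mul_block_col !mul0mx addr0 add0r.
have key : Q^T *m (H *m (S *m (F *m Q^T))) = Q^T.
  by rewrite -[RHS]mul1mx -QHF !mulmxA.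
have -> : M - M *m (H *m S) *m F *m Q^T =
    U' *m col_mx 0 1%:M *m (Sigma_perp m n r sigma *m (Qperp^T - K *m Q^T)).
  rewrite ME -!mulmxA -mulmxBr; congr (_ *m _).
  rewrite !mul_col_mx opp_col_mx add_col_mx mul0mx mul1mx; congr col_mx.
    by rewrite -!mulmxA key subrr.
  by rewrite mulmxBr /K !mulmxA.
have [QQ PP] : opbnd (row_mx Q Qperp)^T 1 /\ opbnd Qperp^T 1.
  split; first by apply: opbnd_tr => //; exact: opbnd_orthonormal.
  apply: opbnd_tr => //; apply: opbnd_orthonormal.
  move: hW; rewrite /orthonormal_cols tr_row_mx mul_col_row scalar_mx_block.
  by move=> /(congr1 drsubmx); rewrite !block_mxKdr.
have hK : opbnd K kappa.
  rewrite /K -[kappa]mul1r -[1]mulr1; apply: opbnd_mul => //.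
  by apply: opbnd_mul => //; exact: opbnd_orthonormal.
(* Young's inequality with weight [kappa] puts the same factor [1 + kappa] on [|Q^T x|^2] and
   [|Qperp^T x|^2], whose sum is at most [|x|^2]. *)
have hD : opbnd (Qperp^T - K *m Q^T) (1 + kappa).
  move=> x; have := QQ x; rewrite tr_row_mx mul_col_mx.
  have -> : fro2 (col_mx (Q^T *m x) (Qperp^T *m x)) = fro2 (Q^T *m x) + fro2 (Qperp^T *m x).
    rewrite /fro2 big_split_ord/=; congr (_ + _); apply: eq_bigr => i _.
      by apply: eq_bigr => j _; rewrite col_mxEu.
    by apply: eq_bigr => j _; rewrite col_mxEd.
  rewrite mul1r mulmxBl -mulmxA => h.
  set q := Q^T *m x in h *; set pp := Qperp^T *m x in h *.
  apply: (@le_trans _ _ ((1 + kappa) * fro2 pp + (1 + kappa^-1) * fro2 (K *m q))).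
    exact: fro2_sub_le.
  have h2 := hK q.
  have h3 : (1 + kappa^-1) * fro2 (K *m q) <= (1 + kappa) * fro2 q.
    have -> : (1 + kappa) * fro2 q = (1 + kappa^-1) * (kappa * fro2 q).
      by field; rewrite gt_eqF.
    by rewrite ler_wpM2l// addr_ge0// invr_ge0 ltW.
  apply: (le_trans (lerD (lexx _) h3)); rewrite -mulrDr; apply: ler_wpM2l.
    by rewrite addr_ge0// ltW.
  by rewrite addrC.
have k1 : 0 <= 1 + kappa by rewrite addr_ge0// ltW.
have E1 : opbnd (C *m (U' *m col_mx 0 1%:M : 'M[R]_(m, m - r))) 1.
  rewrite -[X in opbnd _ X]mulr1; apply: opbnd_mul => //.
  apply: opbnd_orthonormal; rewrite /orthonormal_cols trmx_mul -mulmxA (mulmxA U'^T) hU' mul1mx.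
  by rewrite tr_col_mx mul_row_col trmx0 mul0mx add0r trmx1 mulmx1.
rewrite [C *m _]mulmxA; apply: (le_trans (mxnorm_mull k _ ler01 E1)); rewrite sqrtr1 mul1r.
exact: mxnorm_mulr.
Qed.

(** Since [G Q Q^T = G], the matrix [F = W^T (W W^T)^-1 G Q] satisfies [G Q (Q^T H F) = W F = G Q],
    and [G Q] can be cancelled. Its bound combines [|W^+|^2 <= 1 / b] with [|G Q|^2 <= a]. *)
Lemma ex_right_inverse (R : realType) (r n l : nat) (G : 'M[R]_(r, n)) (Q : 'M[R]_(n, r))
    (H : 'M[R]_(n, l)) (a b : R) :
  row_space_onb G Q -> 0 <= a -> 0 < b ->
  (forall u : 'rV_r, fro2 (u *m G) <= a * fro2 u) ->
  (forall u : 'rV_r, b * fro2 u <= fro2 (u *m (G *m H))) ->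
  exists2 F : 'M[R]_(l, r), Q^T *m H *m F = 1%:M & opbnd F (a / b).
Proof.
move=> [hQ /andP[/submxP[C QE] /submxP[E GE]]] a0 b0 hG hW.
set W := G *m H in hW; set B := W *m W^T.
have GQQ : G *m Q *m Q^T = G by rewrite GE -(mulmxA E) hQ mulmx1.
have fW : row_free W.
  rewrite -kermx_eq0; apply/eqP/row_matrixP => i; rewrite row0.
  have : row i (kermx W) *m W = 0 by apply: sub_kermxP; exact: row_sub.
  set v := row i _ => vW; have := hW v; rewrite vW fro2_0 => h.
  apply/eqP; rewrite -fro2_eq0 eq_le fro2_ge0 andbT.
  by rewrite -(ler_pM2l b0) mulr0.
have uB : B \in unitmx by exact: gram_unitmx.
(* As [C *m (G *m Q) = Q^T *m Q = 1], the full rank of [G] follows from [row_space_onb]. *)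
have uGQ : G *m Q \in unitmx.
  by have := mulmx1_unit (A := C) (B := G *m Q); rewrite mulmxA -QE hQ => /(_ erefl) [].
exists (W^T *m invmx B *m (G *m Q)).
  set F := _ *m (G *m Q).
  have e : G *m Q *m (Q^T *m H *m F) = G *m Q.
    by rewrite !mulmxA GQQ -/W -/B mulmxV// mul1mx.
  by rewrite -[LHS](mulKmx uGQ) e mulVmx.
rewrite mulrC; apply: opbnd_mul; first by rewrite invr_ge0 ltW.
  (* Here [z = |W^+ y|^2 = (h, y)]; Cauchy-Schwarz and [b |h|^2 <= z] yield [b z <= |y|^2]. *)
  move=> y; set h := invmx B *m y.
  rewrite -mulmxA -/h; set z := fro2 (W^T *m h).
  have zE : z = (h^T *m y) 0 0.
    by rewrite /z -fro2_col trmx_mul trmxK -mulmxA (mulmxA W) -/B mulKVmx.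
  have hz : b * fro2 h <= z.
    by have := hW h^T; rewrite fro2_tr -[fro2 (h^T *m W)]fro2_tr trmx_mul trmxK.
  have := cauchy_schwarz h y; rewrite -zE => cs.
  have y0 := fro2_ge0 y; have h0 := fro2_ge0 h; have z0 : 0 <= z := fro2_ge0 _.
  rewrite mulrC ler_pdivlMr//.
  have [->|zn] := eqVneq z 0; first by rewrite mul0r.
  have zp : 0 < z by rewrite lt_neqAle eq_sym zn.
  by rewrite -(ler_pM2l zp); nra.
rewrite -[a]mulr1; apply: opbnd_mul => //; last exact: opbnd_orthonormal.
rewrite -[G]trmxK; apply: opbnd_tr => // x.
by rewrite -fro2_tr trmx_mul trmxK -[in leRHS]fro2_tr; exact: hG.
Qed.

Lemma fro2_homog (R : realType) (r q : nat) (A : 'M[R]_(r, q)) (b : R) :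
  (forall u : 'rV_r, fro2 u = 1 -> b <= fro2 (u *m A)) ->
  forall u : 'rV_r, b * fro2 u <= fro2 (u *m A).
Proof.
move=> hA u; have [u0|u0] := eqVneq (fro2 u) 0; first by rewrite u0 mulr0 fro2_ge0.
have up : 0 < fro2 u by rewrite lt_neqAle eq_sym u0 fro2_ge0.
have := hA ((Num.sqrt (fro2 u))^-1 *: u).
rewrite -scalemxAl !fro2_scale exprVn sqr_sqrtr ?(ltW up)// mulVf// => /(_ erefl).
by rewrite mulrC ler_pdivlMr.
Qed.

(** * From net points to all vectors *)

Lemma quad_gram (R : realType) (r q : nat) (A : 'M[R]_(r, q)) (c : R) (x : 'rV[R]_r) :
  quad (A *m A^T - c%:M) x = fro2 (x *m A) - c * fro2 x.
Proof.
rewrite /quad mulmxBr mulmxBl [LHS]mxE [X in _ + X]mxE; congr (_ - _).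
  by rewrite -fro2_row trmx_mul !mulmxA.
by rewrite mul_mx_scalar -scalemxAl -fro2_row mxE.
Qed.

Lemma quadN (R : realType) (r : nat) (B : 'M[R]_r) (x : 'rV[R]_r) : quad (- B) x = - quad B x.
Proof. by rewrite /quad mulmxN mulNmx mxE. Qed.

Lemma gram_sub_diag (R : realType) (r q : nat) (A : 'M[R]_(r, q)) (c : R) i :
  (A *m A^T - c%:M) i i = \sum_j A i j ^+ 2 - c.
Proof.
rewrite [LHS]mxE [X in _ + X]mxE [X in _ - X]mxE eqxx mulr1n [X in X - _]mxE.
by congr (_ - _); apply: eq_bigr => j _; rewrite mxE expr2.
Qed.

Definition net_vec (R : realType) (r : nat)
    (z : {ffun 'I_r -> 'I_(3 * r + (3 * r).+1)}) : 'rV[R]_r :=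
  \row_i (shifted (z i))%:~R.

(** Round the form [|u A|^2 - c |u|^2], whose diagonal entries are at most the squared row norms of
    [A]: the loss is at most [t / (16 r)]. A unit vector with [|u A|^2 < b] would give a net point
    where the form is negative. *)
Lemma net_lower (R : realType) (r q : nat) (A : 'M[R]_(r, q)) (b c t : R) :
  (0 < r)%N -> 0 <= c -> fro2 A <= t -> b + t / (16 * r%:R) <= c ->
  (forall z, z \in l1_net r -> net_vec R z != 0 ->
     c * fro2 (net_vec R z) <= fro2 (net_vec R z *m A)) ->
  forall u : 'rV_r, b * fro2 u <= fro2 (u *m A).
Proof.
move=> r0 c0 hA bc hz; apply: fro2_homog => u u1; rewrite leNgt; apply/negP => ub.
have r1 : 0 < r%:R :> R by rewrite ltr0n.
have BD i : (A *m A^T - c%:M) i i <= \sum_j A i j ^+ 2.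
  by rewrite gram_sub_diag lerBlDr lerDl.
have [z zn] := net_quad r0 u1 (fun i => sumr_ge0 _ (fun j _ => sqr_ge0 (A i j))) BD.
rewrite !quad_gram u1 mulr1 -/(fro2 A) -/(net_vec R z) => zQ.
have h : c * fro2 (net_vec R z) <= fro2 (net_vec R z *m A).
  have [->|/(hz _ zn)//] := eqVneq (net_vec R z) 0.
  by rewrite mul0mx !fro2_0 mulr0.
have : 0 <= (4 * r%:R)^-1 * (fro2 (net_vec R z *m A) - c * fro2 (net_vec R z)).
  by rewrite mulr_ge0 ?subr_ge0// invr_ge0 mulr_ge0// ltW.
have : (16 * r%:R)^-1 * fro2 A <= t / (16 * r%:R).
  by rewrite mulrC ler_wpM2r// invr_ge0 mulr_ge0// ltW.
lra.
Qed.

(** Round the opposite form [c |u|^2 - |u A|^2]. Its [r] diagonal entries are at most [c], so the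
    loss is [c / 16], whence the factor [17 / 16]. *)
Lemma net_upper (R : realType) (r q : nat) (A : 'M[R]_(r, q)) (c : R) :
  (0 < r)%N -> 0 <= c ->
  (forall z, z \in l1_net r -> net_vec R z != 0 ->
     fro2 (net_vec R z *m A) <= c * fro2 (net_vec R z)) ->
  forall u : 'rV_r, fro2 (u *m A) <= 17 / 16 * c * fro2 u.
Proof.
move=> r0 c0 hz.
have r1 : 0 < r%:R :> R by rewrite ltr0n.
suff unit_case (u : 'rV_r) : fro2 u = 1 -> fro2 (u *m A) <= 17 / 16 * c.
  move=> u; have [u0|u0] := eqVneq (fro2 u) 0.
    by move/eqP: (u0); rewrite fro2_eq0 => /eqP ->; rewrite mul0mx !fro2_0 mulr0.
  have up : 0 < fro2 u by rewrite lt_neqAle eq_sym u0 fro2_ge0.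
  have := unit_case ((Num.sqrt (fro2 u))^-1 *: u).
  rewrite -scalemxAl !fro2_scale exprVn sqr_sqrtr ?(ltW up)// mulVf// => /(_ erefl).
  by rewrite mulrC ler_pdivrMr.
move=> u1; rewrite leNgt; apply/negP => ub.
have BD i : (- (A *m A^T - c%:M)) i i <= c.
  rewrite [leLHS]mxE gram_sub_diag opprB lerBlDr lerDl.
  by apply: sumr_ge0 => j _; exact: sqr_ge0.
have [z zn] := net_quad r0 u1 (fun=> c0) BD.
rewrite !quadN !quad_gram u1 mulr1 -/(net_vec R z) sumr_const card_ord => zQ.
have h : fro2 (net_vec R z *m A) <= c * fro2 (net_vec R z).
  have [->|/(hz _ zn)//] := eqVneq (net_vec R z) 0.
  by rewrite mul0mx !fro2_0 mulr0.
have : 0 <= (4 * r%:R)^-1 * - (fro2 (net_vec R z *m A) - c * fro2 (net_vec R z)).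
  by rewrite mulr_ge0 ?oppr_ge0 ?subr_le0// invr_ge0 mulr_ge0// ltW.
have e16 : (16 * r%:R)^-1 * (c *+ r) = c / 16.
  by rewrite -mulr_natr; field; rewrite gt_eqF.
rewrite e16 in zQ; lra.
Qed.

(** * Numerical estimates and tail events *)

Lemma sqrtr_expR (R : realType) (y : R) : Num.sqrt (expR y) = expR (y / 2).
Proof.
have -> : expR y = expR (y / 2) ^+ 2 by rewrite -expRM_natr divfK.
by rewrite sqrtr_sqr ger0_norm ?expR_ge0.
Qed.

Lemma invr_sqrt_exp (R : realType) (c : R) (k : nat) : 0 < c ->
  (Num.sqrt (c ^+ k))^-1 = expR (- (k%:R * ln c / 2)).
Proof.
move=> c0; have -> : c ^+ k = expR (k%:R * ln c) by rewrite expRM_natl lnK ?posrE.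
by rewrite sqrtr_expR expRN.
Qed.

Lemma expR_double (R : realType) (a b y : R) :
  0 <= a -> b <= a * a -> a <= expR y -> b <= expR (y + y).
Proof.
by move=> a0 ba ay; rewrite expRD (le_trans ba)// ler_pM.
Qed.

(** Six squarings of [expR y >= 1 + y] at [y = 1 / 90], with intermediate values rounded down to
    simple fractions, show [expR (64 / 90) >= 2]. *)
Lemma ln2_le (R : realType) : ln 2 <= 32 / 45 :> R.
Proof.
rewrite -ler_expR lnK ?posrE//; set y : R := 90^-1.
have -> : 32 / 45 = y *+ 32 + y *+ 32 by rewrite /y; lra.
apply: (@expR_double _ (58 / 41)); [lra|lra|rewrite (mulrnDr y 16 16)].
apply: (@expR_double _ (157 / 132)); [lra|lra|rewrite (mulrnDr y 8 8)].
apply: (@expR_double _ (349 / 320)); [lra|lra|rewrite (mulrnDr y 4 4)].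
apply: (@expR_double _ (47 / 45)); [lra|lra|rewrite (mulrnDr y 2 2)].
apply: (@expR_double _ (46 / 45)); [lra|lra|].
apply: (@expR_double _ (1 + y)); rewrite ?expR_ge1Dx// /y; lra.
Qed.

(** As in [ln2_le], with five squarings from [y = - 1 / 47]: [expR (- 32 / 47) >= 1 / 2]. *)
Lemma ln2_ge (R : realType) : 32 / 47 <= ln 2 :> R.
Proof.
rewrite -lerN2 -lnV ?posrE// -ler_expR lnK ?posrE ?invr_gt0//; set y : R := - 47^-1.
have -> : - (32 / 47) = y *+ 16 + y *+ 16 by rewrite /y; lra.
apply: (@expR_double _ (17 / 24)); [lra|lra|rewrite (mulrnDr y 8 8)].
apply: (@expR_double _ (101 / 120)); [lra|lra|rewrite (mulrnDr y 4 4)].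
apply: (@expR_double _ (89 / 97)); [lra|lra|rewrite (mulrnDr y 2 2)].
apply: (@expR_double _ (91 / 95)); [lra|lra|].
apply: (@expR_double _ (1 + y)); rewrite ?expR_ge1Dx// /y; lra.
Qed.

Lemma ln17_le (R : realType) : ln 17 <= 4 * ln 2 + 1 / 16 :> R.
Proof.
have p : 0 < 1 + 1 / 16 :> R by rewrite addr_gt0// divr_gt0.
have -> : 17 = 2 ^+ 4 * (1 + 1 / 16) :> R by field.
rewrite lnM ?posrE ?exprn_gt0// lnXn// -[ln 2 *+ 4]mulr_natl lerD2l.
by apply: le_ln1Dx; rewrite (lt_trans _ (@divr_gt0 _ 1 16 _ _))//; lra.
Qed.

Lemma expRN_le (R : realType) (x : R) (k : nat) : 0 <= x ->
  expR (- (k%:R * x)) <= ((1 + x) ^+ k)^-1.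
Proof.
move=> x0; rewrite expRN lef_pV2 ?posrE ?expR_gt0 ?exprn_gt0//; last by lra.
by rewrite expRM_natl lerXn2r ?nnegrE ?expR_ge0 ?expR_ge1Dx//; lra.
Qed.

(** The net size against the Chernoff exponent for [c = 1 / 2]: from [ln 17 <= 3] and [36 r < n],
    the net costs at most [n / 12] in the exponent. *)
Lemma numeric_upper (R : realType) (r n : nat) : (36 * r < n)%N ->
  17 ^+ r * expR (n%:R * ln 2 / 2 - 9 / 17 * n%:R) <= expR (- (n%:R / 72)) :> R.
Proof.
move=> rn; have -> : 17 ^+ r = expR (r%:R * ln 17) :> R by rewrite expRM_natl lnK ?posrE.
rewrite -expRD ler_expR.
have n0 : 0 <= n%:R :> R by [].
have r0 : 0 <= r%:R :> R by [].
have rn' : 36 * r%:R <= n%:R :> R by rewrite -natrM ler_nat ltnW.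
have h2 := ln2_le R; have h17 := ln17_le R.
have e1 : r%:R * ln 17 <= r%:R * 3 :> R by apply: ler_wpM2l => //; lra.
have e2 : n%:R * ln 2 <= n%:R * (32 / 45) :> R by exact: ler_wpM2l.
lra.
Qed.

Lemma numeric_lower1 (R : realType) (l : nat) : (0 < l)%N ->
  expR (- (l%:R * ln 2) + 3 / 8 * l%:R) <= expR (- ((l%:R - 1) / 20)) :> R.
Proof.
move=> l0; rewrite ler_expR.
have l1 : 1 <= l%:R :> R by rewrite ler1n.
have e2 : l%:R * (32 / 47) <= l%:R * ln 2 :> R by apply: ler_wpM2l => //; exact: ln2_ge.
lra.
Qed.

Lemma numeric_lower (R : realType) (r l : nat) : (2 <= r)%N -> (22 * (r - 1) < l)%N ->
  17 ^+ r * expR (- (l%:R * ln 2) + 3 / 8 * l%:R) +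
    expR ((r * l)%:R * ln 2 / 2 - 7 / 16 * (r * l)%:R)
  <= expR (- ((l%:R - r%:R) / 20)) :> R.
Proof.
move=> r2 rl; have -> : 17 ^+ r = expR (r%:R * ln 17) :> R by rewrite expRM_natl lnK ?posrE.
have r2' : 2 <= r%:R :> R by rewrite ler_nat.
have rl' : 22 * r%:R - 21 <= l%:R :> R.
  have : (22 * r)%:R <= (l + 21)%:R :> R by rewrite ler_nat; lia.
  rewrite natrM natrD => h; lra.
have h2 := ln2_le R; have h2' := ln2_ge R; have h17 := ln17_le R.
have e1 : r%:R * ln 17 <= r%:R * (128 / 45 + 1 / 16) :> R by apply: ler_wpM2l => //; lra.
have e2 : l%:R * (32 / 47) <= l%:R * ln 2 :> R by exact: ler_wpM2l.
have e3 : (r * l)%:R * ln 2 <= (r * l)%:R * (32 / 45) :> R by exact: ler_wpM2l.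
have e4 : 2 * l%:R <= (r * l)%:R :> R by rewrite natrM ler_wpM2r.
set E := expR (- ((l%:R - r%:R) / 20)).
rewrite -expRD.
(* The net term takes at most the share [17 / 20] of [E] and the Frobenius term at most [3 / 20].
   The tightest case is [r = 2], [l = 23]. *)
apply: (@le_trans _ _ (E * expR (- (2%:R * (17 / 200))) + E * expR (- (4%:R * (13 / 20))))).
  by apply: lerD; rewrite -expRD ler_expR; lra.
rewrite -mulrDr -[leRHS]mulr1 ler_wpM2l ?expR_ge0//.
have i1 : ((1 + 17 / 200) ^+ 2)^-1 <= 17 / 20 :> R.
  by rewrite -div1r ler_pdivrMr ?exprn_gt0//; lra.
have i2 : ((1 + 13 / 20) ^+ 4)^-1 <= 3 / 20 :> R.
  by rewrite -div1r ler_pdivrMr ?exprn_gt0//; lra.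
have f1 : expR (- (2%:R * (17 / 200))) <= 17 / 20 :> R.
  by apply: le_trans i1; apply: expRN_le; lra.
have f2 : expR (- (4%:R * (13 / 20))) <= 3 / 20 :> R.
  by apply: le_trans i2; apply: expRN_le; lra.
lra.
Qed.

(** * Exceptional events for the Gaussian matrix *)

Section gauss_tails.
Variables (d : measure_display) (Omega : measurableType d) (R : realType).
Variables (P : probability Omega R) (r n : nat) (G : 'I_r -> 'I_n -> {RV P >-> R}).
Hypothesis hG : gaussian_matrix G.

Lemma measurable_fro2_mul (s l : nat) (B : 'M[R]_(s, r)) (H : 'M[R]_(n, l)) :
  measurable_fun [set: Omega] (fun w => fro2 (B *m (rv_mx G w *m H))).
Proof.
have := @measurable_fro2_compress _ _ _ P r n G s l B^T H.
by under eq_fun do rewrite trmxK -mulmxA.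
Qed.

Lemma gauss_tail (s l : nat) (B : 'M[R]_(s, r)) (H : 'M[R]_(n, l)) (c t : R) :
  orthonormal_cols B^T -> orthonormal_cols H -> 0 < c ->
  (P [set w | ((1 - c) * t <= (1 - c) * fro2 (B *m (rv_mx G w *m H)))%R] <=
   (expR (- ((s * l)%:R * ln c / 2) - 2^-1 * (1 - c) * t))%:E)%E.
Proof.
move=> hB hH c0; have := gauss_compress_chernoff hG hB hH t c0.
rewrite invr_sqrt_exp// -expRD trmxK.
by under eq_set => w do rewrite -mulmxA.
Qed.

Lemma orthonormal_normalize (x : 'rV[R]_r) : x != 0 ->
  orthonormal_cols ((Num.sqrt (fro2 x))^-1 *: x)^T.
Proof.
move=> x0; have xp : 0 < fro2 x by rewrite lt_neqAle fro2_ge0 eq_sym fro2_eq0 x0.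
rewrite /orthonormal_cols trmxK; apply/matrixP => i j; rewrite !ord1 fro2_row.
by rewrite fro2_scale exprVn sqr_sqrtr ?(ltW xp)// mulVf ?gt_eqF// mxE.
Qed.

(** This is [gauss_tail] with [s = 1] for the unit vector along [x], rescaled by [fro2 x]. *)
Lemma gauss_tail_vec (l : nat) (x : 'rV[R]_r) (H : 'M[R]_(n, l)) (c t : R) :
  x != 0 -> orthonormal_cols H -> 0 < c ->
  (P [set w | ((1 - c) * (t * fro2 x) <= (1 - c) * fro2 (x *m (rv_mx G w *m H)))%R] <=
   (expR (- (l%:R * ln c / 2) - 2^-1 * (1 - c) * t))%:E)%E.
Proof.
move=> x0 hH c0; have xp : 0 < fro2 x by rewrite lt_neqAle fro2_ge0 eq_sym fro2_eq0 x0.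
have := gauss_tail t (orthonormal_normalize x0) hH c0; rewrite mul1n.
congr (_ <= _)%E; congr (P _); apply/seteqP.
have e w : ((1 - c) * t <= (1 - c) * fro2 ((Num.sqrt (fro2 x))^-1 *: x *m (rv_mx G w *m H))) =
  ((1 - c) * (t * fro2 x) <= (1 - c) * fro2 (x *m (rv_mx G w *m H))).
  rewrite -scalemxAl fro2_scale exprVn sqr_sqrtr ?(ltW xp)//.
  set X := fro2 x in xp *; set Y := fro2 _.
  have -> : (1 - c) * (X^-1 * Y) = (1 - c) * Y / X by rewrite mulrCA mulrC.
  by rewrite ler_pdivlMr// mulrA.
by split=> w /=; rewrite e.
Qed.

End gauss_tails.

(** The union is hidden behind a measurable superset, which is the form in which the exceptional
    events are used. *)
Lemma union_bound (d : measure_display) (T : measurableType d) (R : realType)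
    (P : probability T R) (I : finType) (p : {pred I}) (A : I -> set T) (q : R) :
  (forall i, i \in p -> measurable (A i)) -> (forall i, i \in p -> (P (A i) <= q%:E)%E) ->
  exists2 B, measurable B /\ (forall i, i \in p -> A i `<=` B) &
    (P B <= (#|p|%:R * q)%:E)%E.
Proof.
move=> mA hA.
suff [B [mB AB PB]] : exists B, [/\ measurable B,
    (forall i, i \in enum p -> A i `<=` B) & (P B <= ((size (enum p))%:R * q)%:E)%E].
  exists B; last by rewrite cardE.
  by split=> // i ip; apply: AB; rewrite mem_enum.
have : {subset enum p <= p} by move=> i; rewrite mem_enum.
elim: (enum p) => [|i s IH] sub.
  by exists set0; split=> //; rewrite measure0 mul0r.
have [|B [mB AB PB]] := IH; first by move=> j js; apply: sub; rewrite inE js orbT.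
have ip : i \in p by apply: sub; rewrite inE eqxx.
exists (A i `|` B); split.
- by apply: measurableU => //; exact: mA.
- by move=> j; rewrite inE => /orP[/eqP ->|/AB js]; [left|right; exact: js].
- apply: (le_trans (measureU2 _ (mA _ ip) mB)).
  rewrite /= -[(size s).+1]add1n natrD mulrDl mul1r EFinD.
  by apply: leeD => //; exact: hA.
Qed.

Section events.
Variables (d : measure_display) (Omega : measurableType d) (R : realType).
Variables (P : probability Omega R) (n : nat).

Lemma measurable_gauss_le (r s l : nat) (G : 'I_r -> 'I_n -> {RV P >-> R})
    (B : 'M[R]_(s, r)) (H : 'M[R]_(n, l)) (a b : R) :
  measurable [set w | a <= b * fro2 (B *m (rv_mx G w *m H))].
Proof.
rewrite -[X in measurable X]setTI; apply: measurable_fun_le => //.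
by apply: measurable_funM => //; exact: measurable_fro2_mul.
Qed.

(** One Chernoff bound for each nonzero net vector. The sign of [1 - c] again selects the tail, and
    outside [B] the opposite inequality holds at all these points at once. *)
Lemma net_event (r l : nat) (G : 'I_r -> 'I_n -> {RV P >-> R}) (H : 'M[R]_(n, l)) (c t : R) :
  gaussian_matrix G -> orthonormal_cols H -> 0 < c ->
  exists B, [/\ measurable B,
    (P B <= (17 ^+ r * expR (- (l%:R * ln c / 2) - 2^-1 * (1 - c) * t))%:E)%E &
    forall w, ~ B w -> forall z, z \in l1_net r -> net_vec R z != 0 ->
      (1 - c) * fro2 (net_vec R z *m (rv_mx G w *m H)) <= (1 - c) * (t * fro2 (net_vec R z))].
Proof.
move=> hG hH c0.
pose p := [pred z | (z \in l1_net r) && (net_vec R z != 0)].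
set q := expR _.
have [|z /andP[_ z0]|B [mB AB] PB] := @union_bound _ _ R P _ p (fun z =>
    [set w | (1 - c) * (t * fro2 (net_vec R z)) <=
      (1 - c) * fro2 (net_vec R z *m (rv_mx G w *m H))]) q.
- by move=> z _; exact: measurable_gauss_le.
- exact: gauss_tail_vec.
exists B; split=> //.
  apply: (le_trans PB); rewrite lee_fin ler_wpM2r ?expR_ge0//.
  apply: le_trans (card_l1_net R r); rewrite ler_nat.
  by apply: subset_leq_card; apply/fintype.subsetP => z /andP[].
move=> w nB z zn z0; rewrite leNgt; apply/negP => /ltW h; apply: nB.
by apply: (AB z) => //; rewrite inE zn.
Qed.

Lemma upper_event (r : nat) (G : 'I_r -> 'I_n -> {RV P >-> R}) :
  gaussian_matrix G -> (0 < r)%N -> (36 * r < n)%N ->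
  exists B, [/\ measurable B, (P B <= (expR (- (n%:R / 72)))%:E)%E &
    forall w, ~ B w -> forall u : 'rV_r, fro2 (u *m rv_mx G w) <= 9 / 4 * n%:R * fro2 u].
Proof.
move=> hG r0 rn.
have h1 : orthonormal_cols (1%:M : 'M[R]_n) by rewrite /orthonormal_cols trmx1 mulmx1.
(* The threshold is [36 / 17 * n] because [net_upper] multiplies it by [17 / 16], which gives
   [9 / 4 * n]. *)
have [|B [mB PB hB]] := @net_event r n G 1%:M 2^-1 (36 / 17 * n%:R) hG h1.
  by rewrite invr_gt0.
exists B; split=> //.
  apply: (le_trans PB); rewrite lee_fin; apply: le_trans (numeric_upper R rn).
  rewrite ler_wpM2l ?exprn_ge0// ler_expR lnV ?posrE//; lra.
move=> w nB u; have -> : 9 / 4 * n%:R = 17 / 16 * (36 / 17 * n%:R) :> R by field.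
apply: net_upper => // z zn z0; have := hB w nB z zn z0; rewrite mulmx1.
by rewrite ler_pM2l//; lra.
Qed.

Lemma ln4E : ln 4 = 2 * ln 2 :> R.
Proof.
have -> : 4 = 2 ^+ 2 :> R by lra.
by rewrite lnXn// mulr_natl.
Qed.

(** All vectors are multiples of a single unit vector, so one Chernoff bound with [c = 4] suffices;
    its threshold [l / 4] exceeds [9 / 64 * l]. *)
Lemma lower_event1 (l : nat) (G : 'I_1 -> 'I_n -> {RV P >-> R}) (H : 'M[R]_(n, l)) :
  gaussian_matrix G -> orthonormal_cols H -> (0 < l)%N ->
  exists B, [/\ measurable B, (P B <= (expR (- ((l%:R - 1) / 20)))%:E)%E &
    forall w, ~ B w -> forall u : 'rV_1,
      9 / 64 * l%:R * fro2 u <= fro2 (u *m (rv_mx G w *m H))].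
Proof.
move=> hG hH l0.
have h1 : orthonormal_cols (1%:M : 'M[R]_1)^T by rewrite /orthonormal_cols trmxK trmx1 mulmx1.
exists [set w | (1 - 4) * (l%:R / 4) <= (1 - 4) * fro2 (1%:M *m (rv_mx G w *m H))].
split; first exact: measurable_gauss_le.
  apply: (le_trans (gauss_tail hG (l%:R / 4) h1 hH _)) => //.
  rewrite lee_fin mul1n; apply: le_trans (numeric_lower1 R l0).
  by rewrite ler_expR ln4E; lra.
move=> w nB u; have [x ->] : exists x : R, u = x%:M.
  by exists (u 0 0); rewrite -mx11_scalar.
rewrite mul_scalar_mx fro2_scale -[x%:M]mulmx1 mul_scalar_mx fro2_scale.
rewrite -fro2_row trmx1 mulmx1 mxE mulr1 mulrC ler_wpM2l ?sqr_ge0//.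
rewrite leNgt; apply/negP => h; apply: nB => /=; rewrite mul1mx.
have l0' : 0 <= l%:R :> R by [].
lra.
Qed.

(** Outside [B1] the value at net points is at least [l / 4] times their squared length; outside
    [B2] the squared Frobenius norm is at most [7 / 4 * r l]. The loss in [net_lower] is then
    [7 / 64 * l], and [1 / 4 - 7 / 64 = 9 / 64]. *)
Lemma lower_event (r l : nat) (G : 'I_r -> 'I_n -> {RV P >-> R}) (H : 'M[R]_(n, l)) :
  gaussian_matrix G -> orthonormal_cols H -> (0 < r)%N -> (r <= l)%N ->
  (22 * (r - 1) < l)%N ->
  exists B, [/\ measurable B, (P B <= (expR (- ((l%:R - r%:R) / 20)))%:E)%E &
    forall w, ~ B w -> forall u : 'rV_r,
      9 / 64 * l%:R * fro2 u <= fro2 (u *m (rv_mx G w *m H))].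
Proof.
case: r G => [|[|r']] // G hG hH _ rl l22; first exact: lower_event1.
set r := r'.+2 in G hG rl l22 *.
have h1 : orthonormal_cols (1%:M : 'M[R]_r)^T by rewrite /orthonormal_cols trmxK trmx1 mulmx1.
have [//|B1 [mB1 PB1 hB1]] := @net_event r l G H 4 (l%:R / 4) hG hH.
pose B2 := [set w | (1 - 2^-1) * (7 / 4 * (r * l)%:R) <=
  (1 - 2^-1) * fro2 (1%:M *m (rv_mx G w *m H))].
have mB2 : measurable B2 by exact: measurable_gauss_le.
have PB2 : (P B2 <= (expR ((r * l)%:R * ln 2 / 2 - 7 / 16 * (r * l)%:R))%:E)%E.
  apply: (le_trans (gauss_tail hG (7 / 4 * (r * l)%:R) h1 hH _)).
    by rewrite invr_gt0.
  by rewrite lee_fin ler_expR lnV ?posrE//; lra.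
exists (B1 `|` B2); split; first exact: measurableU.
  apply: (le_trans (measureU2 _ mB1 mB2)).
  apply: (le_trans (leeD PB1 PB2)); rewrite -EFinD lee_fin.
  apply: le_trans (numeric_lower R _ l22) => //.
  by rewrite lerD2r ler_wpM2l ?exprn_ge0// ler_expR ln4E; lra.
move=> w /not_orP[nB1 nB2]; apply: (@net_lower _ _ _ _ _ (l%:R / 4) (7 / 4 * (r * l)%:R)) => //.
- rewrite leNgt; apply/negP => h; apply: nB2; rewrite /B2/= mul1mx.
  by apply: ler_wpM2l; [lra|exact: ltW].
- have r0 : r%:R != 0 :> R by rewrite pnatr_eq0.
  rewrite natrM; have -> : 7 / 4 * (r%:R * l%:R) / (16 * r%:R) = 7 / 64 * l%:R :> R by field.
  lra.
- move=> z zn z0; have := hB1 w nB1 z zn z0.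
  lra.
Qed.

End events.

(** * Combining the deterministic bound with the tail events *)

Lemma prob_at_least_sub (d : measure_display) (Omega : measurableType d) (R : realType)
    (P : probability Omega R) (A B : set Omega) (p : R) :
  A `<=` B -> prob_at_least P A p -> prob_at_least P B p.
Proof. by move=> AB [E [mE EA pE]]; exists E; split=> //; exact: subset_trans AB. Qed.

(** The ratio of [9 / 4 * n] to [9 / 64 * l] is the [16 * n / l] of the conclusion. *)
Lemma residual_le_tail (R : realType) (k : norm_kind) (m n r l : nat) (hrm : (r <= m)%N)
    (sigma : nat -> R) (G : 'M[R]_(r, n)) (U : 'M[R]_m) (Q : 'M[R]_(n, r))
    (Qperp : 'M[R]_(n, n - r)) (H : 'M[R]_(n, l)) (S T : 'M[R]_l) :
  (r <= n)%N -> (n <= m)%N -> (0 < n)%N -> (0 < l)%N -> noninc_nonneg n sigma ->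
  row_space_onb G Q -> row_space_perp_onb G Qperp -> orthonormal_cols U ->
  orthonormal_cols (H *m S) -> T \in unitmx ->
  (forall u : 'rV_r, fro2 (u *m G) <= 9 / 4 * n%:R * fro2 u) ->
  (forall u : 'rV_r, 9 / 64 * l%:R * fro2 u <= fro2 (u *m (G *m (H *m S)))) ->
  let M := factor_mx hrm sigma U Q Qperp in
  mxnorm k (M - sketch_X M H T *m sketch_Y M H T) <=
    Num.sqrt (1 + 16 * n%:R / l%:R) * tail_sigma k r M.
Proof.
move=> rn nm n0 l0 hs hQ hP hU hH uT hup hlow; cbv zeta.
have n1 : 0 < n%:R :> R by rewrite ltr0n.
have l1 : 0 < l%:R :> R by rewrite ltr0n.
have hW := orthonormal_row_mx hQ hP.
have b0 : 0 < 9 / 64 * l%:R :> R by rewrite mulr_gt0// divr_gt0.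
have a0 : 0 <= 9 / 4 * n%:R :> R by rewrite mulr_ge0// divr_ge0.
have [F QHF hF] := ex_right_inverse hQ a0 b0 hup hlow.
have ab : 9 / 4 * n%:R / (9 / 64 * l%:R) = 16 * n%:R / l%:R :> R.
  by field; rewrite gt_eqF.
rewrite ab in hF.
have k0 : 0 < 16 * n%:R / l%:R :> R by rewrite divr_gt0// mulr_gt0.
apply: (le_trans (residual_bound k hrm sigma hU hW uT hH QHF k0 hF)).
have [V svd] := factor_mx_svd hrm nm rn hs hU hW.
by rewrite ler_wpM2l ?sqrtr_ge0//; exact: Sigma_perp_le_tail svd.
Qed.

Theorem theorem5p1 (R : realType) (d : measure_display) (Omega : measurableType d)
    (P : probability Omega R) (nk : norm_kind) (m n r l : nat)
    (hr0 : (0 < r)%N) (hrn : (r < n)%N) (hnm : (n <= m)%N)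
    (hrl : (r <= l)%N) (hl : (l < minn m n)%N)
    (hn : (36 * r < n)%N) (hl22 : (22 * (r - 1) < l)%N)
    (sigma : nat -> R) (hsigma : noninc_nonneg n sigma) (hsigma_r : 0 < sigma r)
    (G : 'I_r -> 'I_n -> {RV P >-> R}) (hG : gaussian_matrix G)
    (Q : Omega -> 'M[R]_(n, r)) (Qperp : Omega -> 'M[R]_(n, n - r)) (U : Omega -> 'M[R]_m)
    (hQ : {ae P, forall w, row_space_onb (rv_mx G w) (Q w)})
    (hQperp : {ae P, forall w, row_space_perp_onb (rv_mx G w) (Qperp w)})
    (hU : {ae P, forall w, orthonormal_cols (U w)})
    (H : 'M[R]_(n, l)) (T : 'M[R]_l) (hT : T \in unitmx) :
  let M w := factor_mx (leq_trans (ltnW hrn) hnm) sigma (U w) (Q w) (Qperp w) in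
  let X w := sketch_X (M w) H T in
  let Y w := sketch_Y (M w) H T in
  let prob := 1 - expR (- (n%:R / 72)) - expR (- ((l%:R - r%:R) / 20)) in
  (orthonormal_cols H ->
     prob_at_least P
       [set w | 0 < tail_sigma nk r (M w) ->
          mxnorm nk (M w - X w *m Y w) / tail_sigma nk r (M w)
            <= Num.sqrt (1 + 16 * n%:R / l%:R)]
       prob) /\
  (\rank H = l ->
     prob_at_least P
       [set w | 0 < tail_sigma nk r (M w) ->
          mxnorm nk (M w - X w *m Y w) / tail_sigma nk r (M w)
            <= Num.sqrt (1 + 16 * cond_number H ^+ 2 * n%:R / l%:R)]
       prob).
Proof.
move=> M X Y prob.
have l0 : (0 < l)%N := leq_trans hr0 hrl.
have n0 : (0 < n)%N := leq_trans hr0 (ltnW hrn).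
(* Both claims are instances: [S = 1] for orthonormal columns, and the [S] of [orthonormalize] for
   full rank. *)
have main (S : 'M[R]_l) : orthonormal_cols (H *m S) ->
    prob_at_least P [set w | 0 < tail_sigma nk r (M w) ->
      mxnorm nk (M w - X w *m Y w) / tail_sigma nk r (M w)
        <= Num.sqrt (1 + 16 * n%:R / l%:R)] prob.
  move=> hHS.
  have [B1 [mB1 PB1 hB1]] := upper_event hG hr0 hn.
  have [B2 [mB2 PB2 hB2]] := lower_event hG hHS hr0 hrl hl22.
  (* [N] is a measurable null set outside which [Q], [Qperp] and [U] are as required. *)
  have [N [mN PN0 hN]] := negligibleU (negligibleU hQ hQperp) hU.
  exists (~` (B1 `|` B2 `|` N)); split.
  - by apply: measurableC; apply: measurableU => //; exact: measurableU.
  - move=> w /= /not_orP[/not_orP[nB1 nB2] nN] tail0.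
    have [[/contrapT hQw /contrapT hPw] /contrapT hUw] :
        (~ ~ row_space_onb (rv_mx G w) (Q w) /\
         ~ ~ row_space_perp_onb (rv_mx G w) (Qperp w)) /\
         ~ ~ orthonormal_cols (U w).
      by split; [split|] => h; apply: nN; apply: hN; [left; left|left; right|right].
    rewrite ler_pdivrMr//.
    exact: (residual_le_tail nk _ (ltnW hrn) hnm n0 l0 hsigma hQw hPw hUw hHS hT
      (hB1 _ nB1) (hB2 _ nB2)).
  - rewrite probability_setC; last by apply: measurableU => //; exact: measurableU.
    have PB : (P (B1 `|` B2 `|` N) <=
        (expR (- (n%:R / 72)) + expR (- ((l%:R - r%:R) / 20)))%:E)%E.
      apply: (le_trans (measureU2 P (measurableU _ _ mB1 mB2) mN)).
      rewrite -[leRHS]adde0; apply: leeD; last by rewrite PN0.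
      by rewrite EFinD (le_trans (measureU2 P mB1 mB2))// leeD.
    rewrite /prob -addrA -opprD EFinB.
    exact: leeB.
split=> [hH|rH]; first by apply: (main 1%:M); rewrite mulmx1.
have [S hHS] := orthonormalize rH.
(* Since [cond_number H >= 1], the bound of the orthonormal case implies the weaker one claimed
   here. *)
apply: prob_at_least_sub (main S hHS) => w /= h tail0; apply: (le_trans (h tail0)).
rewrite ler_sqrt; last first.
  by rewrite addr_ge0// divr_ge0// mulr_ge0// mulr_ge0// sqr_ge0.
rewrite lerD2l ler_pM2r ?invr_gt0 ?ltr0n//; apply: ler_wpM2r => //.
rewrite ler_peMr// exprn_ege1//; exact: cond_number_ge1.
Qed.
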